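(* Let $\{\boldsymbol{\xi}_t\}_{0\le t\le1}$ be an $n$-dimensional GLP with generating law $\nu$ and activity parameter $\mathbf{m}$, and let $R_t=\mathbf{1}\cdot\boldsymbol{\xi}_t$. Then $\{R_t\}_{0\le t\le1}$ is an LRB with generating law $\nu$ and the transition law $$\mathbb{P}(R_1\in dr\mid\boldsymbol{\xi}_s=\mathbf{x})=\frac{\theta_s(dr;\mathbf{1}\cdot\mathbf{x})}{\Theta_s(\mathbf{1}\cdot\mathbf{x})},\qquad 0\le s<1,$$ $$\mathbb{P}(R_t\in dr\mid\boldsymbol{\xi}_s=\mathbf{x})=\frac{\Theta_t(r)}{\Theta_s(\mathbf{1}\cdot\mathbf{x})}f_{(t-s)(\mathbf{1}\cdot\mathbf{m})}(r-\mathbf{1}\cdot\mathbf{x})\,dr,\qquad 0\le s<t<1.$$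
   Context: For $\mathbf{x}\in\mathbb{R}^n$ write $\mathbf{1}\cdot\mathbf{x}=\sum_i x_i$. All processes are càdlàg on a probability space $(\Omega,\mathcal{F},\mathbb{P})$. Lévy random bridge (LRB). Let $T>0$, let $\nu$ be a probability law on $\mathbb{R}$, and let $\{X_t\}$ be a real-valued Lévy process such that $X_t$ has a density $f_t$ for all $t\in(0,T]$, with $f_t(x)=\int_{\mathbb{R}}f_{t-s}(x-y)f_s(y)\,dy$ for $0<s<t\le T$, $x\in\mathbb{R}$, and $0<f_T(z)<\infty$ for $\nu$-a.e. $z$. A process $\{L_t\}_{0\le t\le T}$ is an LRB with generating law $\nu$ if $L_T$ has law $\nu$ and, for all $k\ge 1$, $0<t_1<\cdots<t_k<T$, $(x_1,\dots,x_k)\in\mathbb{R}^k$ and $\nu$-a.e. $z$, $\mathbb{P}(L_{t_1}\le x_1,\dots,L_{t_k}\le x_k\mid L_T=z)=\mathbb{P}(X_{t_1}\le x_1,\dots,X_{t_k}\le x_k\mid X_T=z)$. Equivalently (with $t_0=0$, $x_0=0$), $$\mathbb{P}(L_{t_1}\in dx_1,\dots,L_{t_k}\in dx_k,L_T\in dz)=\prod_{i=1}^k\big(f_{t_i-t_{i-1}}(x_i-x_{i-1})\,dx_i\big)\frac{f_{T-t_k}(z-x_k)}{f_T(z)}\,\nu(dz).$$ Generalised Liouville process (GLP). Let $n\ge2$, $m_1,\dots,m_n>0$, $u_0=0$, $u_i=u_{i-1}+m_i$ (so $u_n=\mathbf{1}\cdot\mathbf{m}$). A process $\{\boldsymbol{\xi}_t\}_{0\le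 t\le1}$ is an $n$-dimensional GLP with generating law $\nu$ and activity parameter $\mathbf{m}=(m_1,\dots,m_n)^\top$ if it is equal in law to the process with coordinates $L_{tm_i+u_{i-1}}-L_{u_{i-1}}$, $i=1,\dots,n$, $0\le t\le1$, for some LRB $\{L_t\}_{0\le t\le u_n}$ with generating law $\nu$; $f_t$ denotes the marginal densities of the associated Lévy process. It is assumed throughout that $\nu$ has no continuous singular part. For $t\in(0,1)$, $x\in\mathbb{R}$, $B\in\mathcal{B}(\mathbb{R})$, define $$\theta_0(B;x)=\nu(B),\qquad \theta_t(B;x)=\int_B\frac{f_{(\mathbf{1}\cdot\mathbf{m})(1-t)}(z-x)}{f_{\mathbf{1}\cdot\mathbf{m}}(z)}\,\nu(dz),\qquad \Theta_t(x)=\theta_t(\mathbb{R};x).$$ Ratios of densities are understood to be well defined almost surely. *)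

(* Defs.v *)
From HB Require Import structures.
From mathcomp Require Import all_boot all_order all_algebra.
From mathcomp Require Import all_classical all_reals all_analysis.
From mathcomp Require Import measurable_realfun.
Import numFieldNormedType.Exports.

Set Implicit Arguments.
Unset Strict Implicit.
Unset Printing Implicit Defensive.

Import Order.TTheory GRing.Theory Num.Theory.
Local Open Scope classical_set_scope.
Local Open Scope ring_scope.

Section processes.
Context (R : realType).

(* At the left (resp. right) endpoint of D the filter [within D t^'-]
   (resp. [within D t^'+]) is improper, so that the condition is void there. *)
Definition cadlag (D : set R) (x : R -> R) : Prop :=
  forall t, D t ->
    (x s @[s --> within D t^'+] --> x t) /\
    (exists l : R, x s @[s --> within D t^'-] --> l).

Definition real_process d (W : measurableType d) (D : set R)
    (X : R -> W -> R) : Prop :=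
  (forall t, D t -> measurable_fun [set: W] (X t)) /\
  (forall w, cadlag D (X ^~ w)).

Definition vector_process d (W : measurableType d) n (D : set R)
    (X : R -> W -> n.-tuple R) : Prop :=
  forall i : 'I_n, real_process D (fun t w => tnth (X t w) i).

Definition fdd d d' (W : measurableType d) (S : measurableType d') k
    (X : R -> W -> S) (t : k.-tuple R) (w : W) : k.-tuple S :=
  [tuple X (tnth t i) w | i < k].

(* The two processes may live on different probability spaces. *)
Definition equal_in_law d1 d2 d' (W1 : measurableType d1)
    (W2 : measurableType d2) (S : measurableType d') (D : set R)
    (P1 : probability W1 R) (X1 : R -> W1 -> S)
    (P2 : probability W2 R) (X2 : R -> W2 -> S) : Prop :=
  forall (k : nat) (t : k.-tuple R), (forall i, D (tnth t i)) ->
  forall C : set (k.-tuple S), measurable C ->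
    P1 (fdd X1 t @^-1` C) = P2 (fdd X2 t @^-1` C).

Definition levy_process d (W : measurableType d) (P : probability W R)
    (X : R -> W -> R) : Prop :=
  [/\ real_process `[0, +oo[ X,
      {ae P, forall w, X 0 w = 0},
      (* stationary increments *)
      (forall s t : R, 0 <= s -> s <= t -> forall B, measurable B ->
        P ((fun w => X t w - X s w) @^-1` B) = P (X (t - s) @^-1` B)) &
      (* independent increments *)
      (forall (k : nat) (t : nat -> R) (B : nat -> set R),
        0 <= t 0%N -> {homo t : i j / (i <= j)%N >-> i <= j} ->
        (forall i, measurable (B i)) ->
        P (\big[setI/setT]_(i < k)
             ((fun w => X (t i.+1) w - X (t i) w) @^-1` B i)) =
        (\prod_(i < k) P ((fun w => X (t i.+1) w - X (t i) w)%R @^-1` B i))%E)].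

(* Densities take values in [0, +oo]: the pointwise convolution identity
   required below can force them to be infinite at some points. *)
Definition has_density d (W : measurableType d) (P : probability W R)
    (Y : W -> R) (g : R -> \bar R) : Prop :=
  [/\ measurable_fun [set: R] g, forall x, (0 <= g x)%E &
      forall B, measurable B ->
        P (Y @^-1` B) = (\int[lebesgue_measure]_(x in B) g x)%E].

(* g is a version of y |-> P (E | Y = y). *)
Definition cond_prob_version d d' (W : measurableType d)
    (S : measurableType d') (P : probability W R)
    (E : set W) (Y : W -> S) (g : S -> \bar R) : Prop :=
  measurable_fun [set: S] g /\
  forall C, measurable C ->
    P (E `&` Y @^-1` C) = (\int[pushforward P Y]_(y in C) g y)%E.

(* kappa is a regular version of y |-> P (Z \in _ | Y = y); it need only be a
   probability measure for almost every y under the law of Y. *)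
Definition cond_law_version d d' d'' (W : measurableType d)
    (S : measurableType d') (S' : measurableType d'') (P : probability W R)
    (Z : W -> S') (Y : W -> S) (kappa : S -> set S' -> \bar R) : Prop :=
  {ae pushforward P Y, forall y, exists mu : probability S' R,
      forall B, measurable B -> kappa y B = mu B} /\
  (forall B, measurable B -> cond_prob_version P (Z @^-1` B) Y (kappa ^~ B)).

(* Integral over y_1 <= x_1, ..., y_k <= x_k of
     \prod_i f_(t_i - t_(i-1)) (y_i - y_(i-1)) * f_(T - t_k) (z - y_k) / f_T z
   where [txs] lists the pairs (t_i, x_i) and (t_0, y_0) is the start. *)
Fixpoint bridge_integral (f : R -> R -> \bar R) (T z t0 y0 : R)
    (txs : seq (R * R)) : \bar R :=
  if txs is (t, x) :: txs' then
    (\int[lebesgue_measure]_(y in `]-oo, x])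
       (f (t - t0)%R (y - y0)%R * bridge_integral f T z t y txs'))%E
  else (f (T - t0)%R (z - y0)%R / f T z)%E.

(* P (X_(t_1) <= x_1, ..., X_(t_k) <= x_k | X_T = z) for a Levy process X with
   densities f.  As an abstract conditional probability it is only determined
   for Lebesgue-almost every z with 0 < f T z, which is too weak for a
   generating law nu with atoms; the densities of X single out the version. *)
Definition levy_bridge_cdf (f : R -> R -> \bar R) (T : R) k (t x : k.-tuple R)
    (z : R) : \bar R :=
  bridge_integral f T z 0 0 (zip t x).

(* f is the family of marginal densities of the associated Levy process. *)
Definition LRB_with (f : R -> R -> \bar R) (T : R) (nu : probability R R)
    d (W : measurableType d) (P : probability W R) (L : R -> W -> R) : Prop :=
  0 < T /\
  (exists (d' : measure_display) (W' : measurableType d')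
          (P' : probability W' R) (X : R -> W' -> R),
     levy_process P' X /\
     forall t, 0 < t -> t <= T -> has_density P' (X t) (f t)) /\
  (forall s t x : R, 0 < s -> s < t -> t <= T ->
     f t x = (\int[lebesgue_measure]_y (f (t - s)%R (x - y)%R * f s y))%E) /\
  {ae nu, forall z, (0 < f T z < +oo)%E} /\
  real_process `[0, T] L /\
  (forall B, measurable B -> P (L T @^-1` B) = nu B) /\
  (forall (k : nat) (t x : k.+1.-tuple R),
     path <%R 0 (rcons t T) ->
     cond_prob_version P [set w | forall i, L (tnth t i) w <= tnth x i]
       (L T) (levy_bridge_cdf f T t x)).

Definition LRB (T : R) (nu : probability R R)
    d (W : measurableType d) (P : probability W R) (L : R -> W -> R) : Prop :=
  exists f, LRB_with f T nu P L.

Definition ones_dot n (x : n.-tuple R) : R := \sum_(i < n) tnth x i.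

(* u_i = m_1 + ... + m_i; m`_j is the 0-indexed entry m_(j+1). *)
Definition usum n (m : n.-tuple R) (i : nat) : R := \sum_(j < i) m`_j.

Definition GLP_of_LRB n (m : n.-tuple R) d (W : measurableType d)
    (L : R -> W -> R) (t : R) (w : W) : n.-tuple R :=
  [tuple L (t * tnth m i + usum m i) w - L (usum m i) w | i < n].

Definition GLP_with (f : R -> R -> \bar R) n (nu : probability R R)
    (m : n.-tuple R) d (W : measurableType d) (P : probability W R)
    (xi : R -> W -> n.-tuple R) : Prop :=
  vector_process `[0, 1] xi /\
  exists (d' : measure_display) (W' : measurableType d')
         (P' : probability W' R) (L : R -> W' -> R),
    LRB_with f (usum m n) nu P' L /\
    equal_in_law `[0, 1] P xi P' (GLP_of_LRB m L).

(* The Lebesgue decomposition of nu consists of an absolutely continuous and a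
   discrete part only. *)
Definition no_continuous_singular_part (nu : probability R R) : Prop :=
  exists (nu_ac nu_d : {measure set R -> \bar R}) (D : set R),
    [/\ nu_ac `<< (lebesgue_measure : set R -> \bar R),
        countable D, nu_d (~` D) = 0%E &
        forall B, measurable B -> nu B = (nu_ac B + nu_d B)%E].

(* c stands for the total activity 1.m *)
Definition theta (f : R -> R -> \bar R) (c : R) (nu : probability R R)
    (t : R) (B : set R) (x : R) : \bar R :=
  if t == 0 then nu B
  else (\int[nu]_(z in B) (f (c * (1 - t))%R (z - x)%R / f c z))%E.

Definition Theta (f : R -> R -> \bar R) (c : R) (nu : probability R R)
    (t x : R) : \bar R := theta f c nu t setT x.

End processes.

(* Main.v *)
Require Import Defs.
From HB Require Import structures.
From mathcomp Require Import all_boot all_order all_algebra.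
From mathcomp Require Import all_classical all_reals all_analysis.
From mathcomp Require Import measurable_realfun.
Import numFieldNormedType.Exports.

Import Order.TTheory GRing.Theory Num.Theory.
Local Open Scope classical_set_scope.
Local Open Scope ring_scope.

(** The argument rests on exchangeability: the increments of a Levy random bridge
    over the intervals of a subdivision may be permuted, together with the
    intervals, without changing their joint law with the end point.

    A subdivision [0 = s_0 < ... < s_K = 1] and the lengths [m_i] cut [0, 1.m] into
    [n K] intervals of lengths [(s_(j+1) - s_j) m_i]. Laid out coordinate by
    coordinate, the increments of the bridge over them are those of the
    coordinates of the Liouville process. Laid out time step by time step, the
    partial sums over whole time steps are the values of the bridge at the times
    [(1.m) s_j]. The two layouts have the same last interval, so the total of the
    Liouville process has the joint law of a bridge run at speed [1.m], and a
    value [xi_s] may be replaced by the first [n] increments of the second layout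
    ([liouville_joint_law]). The transition laws then express the Markov property
    of one path of the bridge.

    To obtain exchangeability, the iterated integral that defines the finite
    dimensional laws of the bridge is read as an expectation over the Levy
    process ([bridge_integralE]). This shows that the law of the bridge at times
    [a_1 < ... < a_N < T], jointly with its end point, is the product of the law
    of the Levy process at these times and of [nu], weighted by
    [f_(T - a_N) (z - X_(a_N)) / f_T z] ([bridge_law]). The weight is a function
    of the sum of the increments, and by stationarity and independence the law of
    the Levy increments depends only on the interval lengths; hence
    [bridge_exchange]. The pointwise form of the weight in [z] is what makes this
    valid when [nu] has atoms.

    The total at time 1 is [L_T - L_0], so one also needs [L_0 = 0] almost surely
    ([bridge_initial_value]). The defining property of a bridge says nothing about
    time 0; absolute continuity with respect to the Levy process before time [T]
    and right-continuity at 0 give it.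

    For the transition laws, let [V] be the block of Levy increments that
    corresponds to [xi_s]. The law of [xi_s] has density [Theta_s (1.x)] with
    respect to the law of [V], and the joint law of [xi_s] with a later total
    disintegrates over the law of [V] with an explicit kernel of mass
    [Theta_s (1.x)]. Dividing the kernel by its mass gives the conditional law,
    since [Theta_s (1.x)] is almost surely positive and finite
    ([cond_law_of_kernel]). *)

Set Implicit Arguments.
Unset Strict Implicit.
Unset Printing Implicit Defensive.

(** * Joint laws of finitely many real variables *)

(** The image of a measure, packed together with its measure structure for a
    chosen proof of measurability. *)
Definition image_measure {R : realType} d1 d2 (T1 : measurableType d1)
    (T2 : measurableType d2) (mu : {measure set T1 -> \bar R}) (Y : T1 -> T2)
    (mY : measurable_fun setT Y) : {measure set T2 -> \bar R} :=
  measure_function_pushforward__canonical__measure_function_Measure mu mY.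

Section tuple_laws.
Context {R : realType}.

Lemma measurable_fun_nth n q :
  measurable_fun [set: n.-tuple R] (fun v : n.-tuple R => v`_q).
Proof.
have [qn|nq] := ltnP q n; last first.
  rewrite (_ : (fun _ => _) = cst 0); first exact: measurable_cst.
  by apply/funext => v; rewrite nth_default// size_tuple.
rewrite (_ : (fun _ => _) = (fun v => tnth v (Ordinal qn))).
  exact: measurable_tnth.
by apply/funext => v; rewrite (tnth_nth 0).
Qed.

Definition orthant n (x : n.-tuple R) : set (n.-tuple R) :=
  [set v | forall i, tnth v i <= tnth x i].

Lemma measurable_orthant n (x : n.-tuple R) : measurable (orthant x).
Proof.
have -> : orthant x = \bigcap_(i in [set: 'I_n])
    ((fun v => tnth v i) @^-1` `]-oo, tnth x i]%classic).
  apply/seteqP; split => v /=.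
    by move=> vx i _; rewrite /= in_itv/=.
  by move=> vx i; have := vx i I; rewrite /= in_itv.
apply: fin_bigcap_measurable; first exact: finite_finset.
move=> i _; rewrite -[X in measurable X]setTI.
by apply: measurable_tnth => //; exact: measurable_itv.
Qed.

Local Notation orthants n := (range (@orthant n)).

Lemma orthants_generate n :
  @measurable _ (n.-tuple R) `<=` <<s orthants n >>.
Proof.
have coor (i : 'I_n) : @measurable_fun _ _
    (g_sigma_algebraType (orthants n)) R setT (fun v => tnth v i).
  apply: (@measurability _ _ (g_sigma_algebraType (orthants n)) R setT
    (fun v => tnth v i) (@RGenOInfty.G R)).
    exact: RGenOInfty.measurableE.
  move=> _ [_ [a ->] <-]; rewrite setTI.
  rewrite (_ : _ @^-1` _ = ~` \bigcup_k orthant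
      [tuple (if j == i then a else k%:R) | j < n]); last first.
    apply/seteqP; split => v /=; rewrite in_itv/= andbT.
      move=> av [k _ /(_ i)]; rewrite tnth_mktuple eqxx.
      by rewrite leNgt av.
    move=> H; rewrite ltNge; apply/negP => va; apply: H.
    exists (Num.bound (\sum_(j < n) `|tnth v j|)) => // j.
    rewrite tnth_mktuple; case: eqP => [->//|_].
    apply: le_trans (ler_norm _) _.
    apply: le_trans (ltW (archi_boundP _)); last exact: sumr_ge0.
    by rewrite (bigD1 j)//= lerDl sumr_ge0.
  apply: measurableC; apply: bigcup_measurable => k _.
  by apply: sub_sigma_algebra; eexists.
apply: smallest_sub; first exact: smallest_sigma_algebra.
rewrite -bigcup_seq; apply: bigcup_sub => /= i _ A [B mB <-].
exact: coor.
Qed.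

(** Lower orthants are stable under intersection and generate the product
    sigma-algebra, so a joint distribution function determines a law. *)
Lemma tuple_measure_unique n (m1 m2 : {measure set (n.-tuple R) -> \bar R}) :
  (m1 setT < +oo)%E -> (forall x, m1 (orthant x) = m2 (orthant x)) ->
  forall A, measurable A -> m1 A = m2 A.
Proof.
move=> fin1 m12; pose g k := orthant [tuple k%:R : R | _ < n].
apply: (measure_unique (orthants n) g).
- apply/seteqP; split; first exact: orthants_generate.
  apply: smallest_sub; first exact: sigma_algebra_measurable.
  by move=> _ [x _ <-]; exact: measurable_orthant.
- move=> _ _ [x _ <-] [y _ <-].
  exists [tuple Num.min (tnth x i) (tnth y i) | i < n] => //.
  apply/seteqP; split => v /=.
    move=> vxy; split=> i; have := vxy i; rewrite tnth_mktuple le_min.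
      by case/andP.
    by case/andP.
  by case=> vx vy i; rewrite tnth_mktuple le_min vx vy.
- by move=> k; eexists.
- rewrite -subTset => v _.
  exists (Num.bound (\sum_(j < n) `|tnth v j|)) => // j.
  rewrite tnth_mktuple; apply: le_trans (ler_norm _) _.
  apply: le_trans (ltW (archi_boundP _)); last exact: sumr_ge0.
  by rewrite (bigD1 j)//= lerDl sumr_ge0.
- by move=> _ [x _ <-]; exact: m12.
- move=> k; apply: le_lt_trans fin1; apply: le_measure; rewrite ?inE//.
  exact: measurable_orthant.
Qed.

Lemma tuple_law_unique d1 d2 (T1 : measurableType d1) (T2 : measurableType d2)
    (m1 : {measure set T1 -> \bar R}) (m2 : {measure set T2 -> \bar R}) n
    (Y1 : T1 -> n.-tuple R) (Y2 : T2 -> n.-tuple R) :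
  measurable_fun setT Y1 -> measurable_fun setT Y2 -> (m1 setT < +oo)%E ->
  (forall x, m1 (Y1 @^-1` orthant x) = m2 (Y2 @^-1` orthant x)) ->
  forall A, measurable A -> m1 (Y1 @^-1` A) = m2 (Y2 @^-1` A).
Proof.
move=> mY1 mY2 fin m12 A mA.
exact: (@tuple_measure_unique n (image_measure m1 mY1) (image_measure m2 mY2)).
Qed.

Lemma integral_law_eq d1 d2 d3 (T1 : measurableType d1) (T2 : measurableType d2)
    (S : measurableType d3)
    (m1 : {measure set T1 -> \bar R}) (m2 : {measure set T2 -> \bar R})
    (Y1 : T1 -> S) (Y2 : T2 -> S) :
  measurable_fun setT Y1 -> measurable_fun setT Y2 ->
  (forall A, measurable A -> m1 (Y1 @^-1` A) = m2 (Y2 @^-1` A)) ->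
  forall F : S -> \bar R, measurable_fun setT F -> (forall v, 0 <= F v)%E ->
  (\int[m1]_w F (Y1 w) = \int[m2]_w F (Y2 w))%E.
Proof.
move=> mY1 mY2 m12 F mF F0.
have := @ge0_integral_pushforward _ _ _ _ R _ mY1 m1 setT _ measurableT mF.
have := @ge0_integral_pushforward _ _ _ _ R _ mY2 m2 setT _ measurableT mF.
rewrite !preimage_setT => <- // <- //.
by apply: eq_measure_integral => A mA _; exact: m12.
Qed.

Lemma big_setI_ordE T n (F : 'I_n -> set T) :
  \big[setI/setT]_(i < n) F i = [set w | forall i, F i w].
Proof.
rewrite -bigcap_seq; apply/seteqP; split => w Fw i => [|_]; last exact: Fw.
by apply: Fw => /=; rewrite mem_index_enum.
Qed.

Lemma measurable_fun_mktuple d (T : measurableType d) n (Y : 'I_n -> T -> R) :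
  (forall i, measurable_fun setT (Y i)) ->
  measurable_fun setT (fun w => [tuple Y i w | i < n]).
Proof.
move=> mY; apply/measurable_fun_tnthP => i.
rewrite (_ : _ \o _ = Y i); first exact: mY.
by apply/funext => w /=; rewrite tnth_mktuple.
Qed.

(** Products of half-lines are boxes, so the probabilities of boxes determine
    the joint law of finitely many variables. *)
Lemma box_law_unique d1 d2 (T1 : measurableType d1) (T2 : measurableType d2)
    (m1 : {measure set T1 -> \bar R}) (m2 : {measure set T2 -> \bar R}) n
    (Y1 : 'I_n -> T1 -> R) (Y2 : 'I_n -> T2 -> R) :
  (forall i, measurable_fun setT (Y1 i)) ->
  (forall i, measurable_fun setT (Y2 i)) ->
  (m1 setT < +oo)%E ->
  (forall B : 'I_n -> set R, (forall i, measurable (B i)) ->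
     m1 (\big[setI/setT]_(i < n) (Y1 i @^-1` B i)) =
     m2 (\big[setI/setT]_(i < n) (Y2 i @^-1` B i))) ->
  forall F : n.-tuple R -> \bar R, measurable_fun setT F ->
  (forall v, 0 <= F v)%E ->
  (\int[m1]_w F [tuple Y1 i w | i < n] = \int[m2]_w F [tuple Y2 i w | i < n])%E.
Proof.
move=> mY1 mY2 fin box.
have orth (T : Type) (Y : 'I_n -> T -> R) (x : n.-tuple R) :
   (fun w => [tuple Y i w | i < n]) @^-1` orthant x =
   \big[setI/setT]_(i < n) (Y i @^-1` `]-oo, tnth x i]%classic).
  rewrite big_setI_ordE; apply/seteqP; split => w /= H i; have := H i;
    by rewrite tnth_mktuple in_itv.
have m1t := measurable_fun_mktuple mY1.
have m2t := measurable_fun_mktuple mY2.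
apply: integral_law_eq => //; apply: tuple_law_unique => //.
move=> x; rewrite !orth; apply: (box (fun i => `]-oo, tnth x i]%classic)) => i.
exact: measurable_itv.
Qed.

End tuple_laws.

(** * Densities and translations *)

Section densities.
Local Open Scope ereal_scope.
Context d (T : measurableType d) {R : realType}.

Lemma measurable_EFin_indic (D : set T) : measurable D ->
  measurable_fun setT (fun x => (\1_D x)%:E : \bar R).
Proof. by move=> mD; apply/measurable_EFinP; exact: measurable_indic. Qed.

Lemma integral_indicM (mu : {measure set T -> \bar R}) (D : set T)
    (g : T -> \bar R) :
  \int[mu]_(x in D) g x = \int[mu]_x ((\1_D x)%:E * g x).
Proof.
rewrite integral_mkcond; apply: eq_integral => x _.
by rewrite epatch_indic muleC.
Qed.

Import HBNNSimple.

(** By monotone convergence along simple functions. The density may take the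
    value +oo, but the cases in which the product of the limits is undefined are
    harmless, because a vanishing function has vanishing approximations. *)
Lemma integral_density (mu nu : {measure set T -> \bar R}) (g : T -> \bar R) :
  measurable_fun setT g -> (forall x, 0 <= g x) ->
  (forall A, measurable A -> nu A = \int[mu]_(x in A) g x) ->
  forall F : T -> \bar R, measurable_fun setT F -> (forall x, 0 <= F x) ->
  \int[nu]_x F x = \int[mu]_x (F x * g x).
Proof.
move=> mg g0 nuE F mF F0; pose h := nnsfun_approx measurableT mF.
have hF x : (h n x)%:E @[n --> \oo] --> F x.
  exact: cvg_nnsfun_approx.
have nd x : {homo (fun n => (h n x)%:E) : a b / (a <= b)%N >-> a <= b}.
  by move=> a b ab; rewrite lee_fin; exact/lefP/nd_nnsfun_approx.
have mh n : measurable_fun setT (fun x => (h n x)%:E : \bar R).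
  exact/measurable_EFinP.
have simple n : \int[nu]_x (h n x)%:E = \int[mu]_x ((h n x)%:E * g x).
  under eq_integral do rewrite fimfunE -fsumEFin//.
  rewrite ge0_integral_fsum//; last 2 first.
    by move=> r; exact/measurable_EFinP/measurable_funM.
    by move=> r x _; exact: nnfun_muleindic_ge0.
  under [RHS]eq_integral => x _.
    rewrite fimfunE -fsumEFin// ge0_mule_fsuml; last first.
      by move=> r; exact: nnfun_muleindic_ge0.
    over.
  rewrite ge0_integral_fsum//; last 2 first.
    move=> r; apply: emeasurable_funM => //.
    exact/measurable_EFinP/measurable_funM.
    by move=> r x _; rewrite mule_ge0 ?nnfun_muleindic_ge0.
  apply: eq_fsbigr => r; rewrite inE => -[t _ rE].
  have r0 : 0 <= r%:E by rewrite -rE lee_fin.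
  under eq_integral do rewrite EFinM.
  rewrite ge0_integralZl//; last exact/measurable_EFinP.
  under [RHS]eq_integral do rewrite EFinM -muleA.
  rewrite ge0_integralZl//; last 2 first.
    by apply: emeasurable_funM => //; exact/measurable_EFinP.
    by move=> x _; rewrite mule_ge0// lee_fin.
  by rewrite integral_indic// setIT nuE// integral_indicM.
have -> : \int[nu]_x F x = limn (fun n => \int[nu]_x (h n x)%:E).
  rewrite -monotone_convergence//.
  - by apply: eq_integral => x _; apply/esym/cvg_lim.
  - by move=> n x _; rewrite lee_fin.
have -> : \int[mu]_x (F x * g x) = limn (fun n => \int[mu]_x ((h n x)%:E * g x)).
  rewrite -monotone_convergence//.
  - apply: eq_integral => x _; apply/esym/cvg_lim => //.
    have [gx0|gx0] := eqVneq (g x) 0.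
      rewrite gx0 mule0; under eq_fun do rewrite mule0.
      exact: cvg_cst.
    have [Fx0|Fx0] := eqVneq (F x) 0.
      have hx0 n : (h n x)%:E = 0 :> \bar R.
        apply/le_anti/andP; split; last by rewrite lee_fin.
        rewrite -Fx0 -(cvg_lim (@ereal_hausdorff R) (hF x)).
        apply: lime_ge; first by apply/cvg_ex; exists (F x).
        by exists n => // k nk; exact: nd.
      rewrite Fx0 mul0e; under eq_fun do rewrite hx0 mul0e.
      exact: cvg_cst.
    apply: cvgeM => //; last exact: cvg_cst.
    apply: neq0_mule_def; rewrite mule_eq0.
    by rewrite (negbTE gx0) (negbTE Fx0).
  - by move=> n; exact: emeasurable_funM.
  - by move=> n x _; rewrite mule_ge0// lee_fin.
  - by move=> x _ a b ab; rewrite lee_wpmul2r//; exact: nd.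
by congr (limn _); apply/funext => n; exact: simple.
Qed.

Section density_measure.
Variables (mu : {measure set T -> \bar R}) (g : T -> \bar R).
Hypotheses (mg : measurable_fun setT g) (g0 : forall x, 0 <= g x).

Definition density_measure of measurable_fun setT g & (forall x, 0 <= g x) :=
  fun A : set T => \int[mu]_(x in A) g x.

Local Notation nu := (density_measure mg g0).

Let nu0 : nu set0 = 0. Proof. exact: integral_set0. Qed.

Let nu_ge0 A : 0 <= nu A.
Proof. by apply: integral_ge0 => x _; exact: g0. Qed.

HB.instance Definition _ := isMeasure.Build _ _ _ nu nu0 nu_ge0
  (semi_sigma_additive_nng_induced mg g0).

End density_measure.

End densities.

Section lebesgue_translation.
Local Open Scope ereal_scope.
Context {R : realType}.
Local Notation leb := (@lebesgue_measure R).

Let measurable_shift (a : R) : measurable_fun [set: measurableTypeR R]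
  (fun x : measurableTypeR R => (a + x)%R : measurableTypeR R).
Proof. exact: measurable_funD. Qed.

Lemma lebesgue_measure_shift (a : R) (A : set R) : measurable A ->
  leb ((fun x => a + x)%R @^-1` A) = leb A.
Proof.
move=> mA; apply/esym.
pose nu : {measure set (measurableTypeR R) -> \bar R} :=
  image_measure leb (measurable_shift a).
apply: (@lebesgue_measure_unique R nu) => //= _ [[b c]] _ <-.
rewrite /nu /= /pushforward.
rewrite (_ : _ @^-1` _ = `](b - a)%R, (c - a)%R]%classic); last first.
  by apply/seteqP; split => x /=; rewrite !in_itv/= ltrBlDl lerBrDl.
by rewrite !lebesgue_measure_itv/= !lte_fin ltrD2r -!EFinD opprB addrA subrK.
Qed.

Lemma integral_shift (a : R) (F : R -> \bar R) : measurable_fun setT F ->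
  (forall x, 0 <= F x) ->
  \int[leb]_x F x = \int[leb]_x F (a + x)%R.
Proof.
move=> mF F0.
have := @ge0_integral_pushforward _ _ _ _ R _ (measurable_shift a) leb setT F
  measurableT mF (fun x _ => F0 x).
rewrite preimage_setT => <-; apply: eq_measure_integral => A mA _ /=.
by rewrite /pushforward lebesgue_measure_shift.
Qed.

End lebesgue_translation.

(** * Increments of a Levy process *)

Section levy_increments.
Context {R : realType} d (W : measurableType d) (P : probability W R).

Definition increment {U : Type} (X : R -> U -> R) (a : nat -> R) (i : nat)
  (w : U) : R := X (a i.+1) w - X (a i) w.

Variable X : R -> W -> R.
Hypothesis levyX : levy_process P X.

Lemma levy_measurable t : 0 <= t -> measurable_fun setT (X t).
Proof. by move=> t0; have [[mX _] _ _ _] := levyX; apply: mX; rewrite /= in_itv/= t0. Qed.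

Lemma has_density_integral (Y : W -> R) (g : R -> \bar R) :
  measurable_fun setT Y -> has_density P Y g ->
  forall F : R -> \bar R, measurable_fun setT F -> (forall x, 0 <= F x)%E ->
  (\int[P]_w F (Y w) = \int[lebesgue_measure]_y (F y * g y))%E.
Proof.
move=> mY [mg g0 gE] F mF F0.
have mY' : @measurable_fun _ _ W (measurableTypeR R) setT Y by [].
pose nu : {measure set (measurableTypeR R) -> \bar R} :=
  image_measure P mY'.
rewrite -(@integral_density _ _ R lebesgue_measure nu g mg g0 gE F mF F0).
by rewrite (ge0_integral_pushforward mY' P measurableT mF)// preimage_setT.
Qed.

Let P_lty : (P setT < +oo)%E.
Proof. by rewrite probability_setT ltry. Qed.

Section grid.
Variable a : nat -> R.
Hypotheses (a0 : 0 <= a 0%N) (a_nd : {homo a : i j / (i <= j)%N >-> i <= j}).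

Let a_ge0 i : 0 <= a i. Proof. by rewrite (le_trans a0)// a_nd. Qed.

Lemma measurable_increment i : measurable_fun setT (increment X a i).
Proof. by apply: measurable_funB; exact: levy_measurable. Qed.

Lemma levy_increments_box n (B : 'I_n -> set R) :
  (forall i, measurable (B i)) ->
  P (\big[setI/setT]_(i < n) (increment X a i @^-1` B i)) =
  (\prod_(i < n) P (X (a i.+1 - a i)%R @^-1` B i))%E.
Proof.
move=> mB; pose B' j := if insub j is Some i then B i else setT.
have B'E (i : 'I_n) : B' i = B i by rewrite /B' valK.
have [_ _ stat indep] := levyX.
under eq_bigr do rewrite -B'E; under [RHS]eq_bigr do rewrite -B'E.
rewrite (indep n a B')//; last by rewrite /B' => i; case: insubP.
apply: eq_bigr => i _; apply: stat; rewrite ?a_nd// /B'.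
by case: insubP.
Qed.

(** The joint law of the increments is a product, so one of them may be replaced
    by an independent copy, which is integrated against its density. *)
Lemma levy_increments_resample n (j : 'I_n) (g : R -> \bar R) :
  has_density P (X (a j.+1 - a j)) g ->
  forall F : n.-tuple R -> \bar R, measurable_fun setT F ->
  (forall v, 0 <= F v)%E ->
  (\int[P]_w F [tuple increment X a i w | i < n] =
   \int[lebesgue_measure]_y
     (\int[P]_w F [tuple (if i == j then y else increment X a i w) | i < n]
      * g y))%E.
Proof.
move=> Yg F mF F0.
have d0 : 0 <= a j.+1 - a j by rewrite subr_ge0 a_nd.
have mXd := levy_measurable d0.
pose Y2 (i : 'I_n) (w : W * W) :=
  if i == j then X (a j.+1 - a j) w.2 else increment X a i w.1.
have mY2 i : measurable_fun setT (Y2 i).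
  rewrite /Y2; case: eqP => _; first exact: measurableT_comp.
  by apply: measurableT_comp => //; exact: measurable_increment.
have -> : (\int[P]_w F [tuple increment X a i w | i < n] =
    \int[P \x P]_w F [tuple Y2 i w | i < n])%E.
  apply: box_law_unique => //.
  - by move=> i; exact: measurable_increment.
  move=> B mB.
  pose B' i := if i == j then setT else B i.
  have mB' i : measurable (B' i) by rewrite /B'; case: eqP.
  rewrite (_ : \big[setI/setT]_(i < n) (Y2 i @^-1` B i) =
    (\big[setI/setT]_(i < n) (increment X a i @^-1` B' i)) `*`
    (X (a j.+1 - a j) @^-1` B j)); last first.
    rewrite !big_setI_ordE; apply/seteqP; split => -[w1 w2] /=.
      move=> H; split; last by have := H j; rewrite /Y2 eqxx.
      by move=> i; have := H i; rewrite /Y2 /B'; case: eqP.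
    move=> [H1 H2] i; have := H1 i; rewrite /Y2 /B'.
    by case: eqP => [->|].
  apply: etrans; last first.
    apply/esym/product_measure1E; last by rewrite -[X in measurable X]setTI; exact: mXd.
    rewrite big_setI_ordE.
    rewrite (_ : mkset _ = \bigcap_(i in [set: 'I_n]) (increment X a i @^-1` B' i)).
      apply: fin_bigcap_measurable; first exact: finite_finset.
      move=> i _; rewrite -[X in measurable X]setTI.
      exact: measurable_increment.
    by apply/seteqP; split => w H i //; exact: H.
  apply: (etrans (levy_increments_box mB)).
  apply: etrans; last exact: (congr1 (mule ^~ _) (esym (levy_increments_box mB'))).
  rewrite (bigD1 j)//= [in RHS](bigD1 j)//=.
  rewrite /B' eqxx preimage_setT probability_setT mul1e muleC.
  by congr (_ * _)%E; apply: eq_bigr => i /negbTE ->.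
have mFY : measurable_fun setT (fun w => F [tuple Y2 i w | i < n]).
  by apply: measurableT_comp => //; exact: measurable_fun_mktuple.
rewrite fubini_tonelli2//.
pose psi y := (\int[P]_w
  F [tuple (if i == j then y else increment X a i w) | i < n])%E.
rewrite -(has_density_integral mXd Yg (F := psi))//.
- apply: (@measurable_fun_fubini_tonelli_G _ _ W R R P
    (fun p => F [tuple (if i == j then p.2 else increment X a i p.1) | i < n])) => //.
  apply: measurableT_comp => //; apply: measurable_fun_mktuple => i.
  by case: eqP => // _; apply: measurableT_comp => //; exact: measurable_increment.
- by move=> y; apply: integral_ge0.
Qed.

End grid.

(** By stationarity, the product law of the increments depends only on the
    lengths of the intervals, so the intervals may be laid out in any order. *)
Lemma levy_increments_permute (a b : nat -> R) n (s : 'I_n -> 'I_n) :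
  0 <= a 0%N -> {homo a : i j / (i <= j)%N >-> i <= j} ->
  0 <= b 0%N -> {homo b : i j / (i <= j)%N >-> i <= j} ->
  injective s ->
  (forall i : 'I_n, a i.+1 - a i = b (s i).+1 - b (s i)) ->
  forall F : n.-tuple R -> \bar R, measurable_fun setT F ->
  (forall v, 0 <= F v)%E ->
  (\int[P]_w F [tuple increment X a i w | i < n] =
   \int[P]_w F [tuple increment X b (s i) w | i < n])%E.
Proof.
move=> a0 a_nd b0 b_nd s_inj ab F mF F0.
apply: (box_law_unique (Y2 := fun i => increment X b (s i))) => //.
- by move=> i; exact: measurable_increment.
- by move=> i; exact: measurable_increment.
move=> B mB; apply: (etrans (levy_increments_box a0 a_nd mB)).
have -> : \big[setI/setT]_(i < n) (increment X b (s i) @^-1` B i) =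
    \big[setI/setT]_(i < n) (increment X b i @^-1` B (invF s_inj i)).
  by rewrite [RHS](reindex_inj s_inj); apply: eq_bigr => i _; rewrite invF_f.
apply: etrans; last first.
  by apply/esym/(levy_increments_box b0 b_nd) => i; exact: mB.
rewrite [RHS](reindex_inj s_inj).
by apply: eq_bigr => i _; rewrite ab invF_f.
Qed.

End levy_increments.

(** * The bridge integral as an expectation *)

Section ratios.
Context {R : realType}.
Local Open Scope ereal_scope.

Lemma measurable_inve d (S : measurableType d) (h : S -> \bar R) :
  measurable_fun setT h -> (forall x, 0 <= h x) ->
  measurable_fun setT (fun x => (h x)^-1).
Proof.
move=> mh h0.
have -> : (fun x => (h x)^-1) =
    (fun x => if h x == 0 then +oo else ((fine (h x)) `^ (-1))%:E).
  apply/funext => x; have := h0 x; case: (h x) => [r| |] //= r0; last first.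
    by rewrite invey powR_inv1// invr0.
  by rewrite inver eqe; case: eqP => // _; rewrite powR_inv1.
apply: measurable_fun_ifT => //.
  by apply: measurable_fun_eqe.
apply/measurable_EFinP.
exact: (measurableT_comp (measurable_powR _) (measurableT_comp _ mh)).
Qed.

Lemma measurable_dive d (S : measurableType d) (h k : S -> \bar R) :
  measurable_fun setT h -> measurable_fun setT k -> (forall x, 0 <= k x) ->
  measurable_fun setT (fun x => h x / k x).
Proof. by move=> mh mk k0; apply: emeasurable_funM => //; exact: measurable_inve. Qed.

End ratios.

Section bridge_expectation.
Context {R : realType}.
Variables (f : R -> R -> \bar R) (T : R).

(** The likelihood ratio, relative to the Levy process at time [s], of the
    bridge conditioned to end at [z]. *)
Definition bridge_ratio (s x z : R) : \bar R := (f (T - s) (z - x)%R / f T z)%E.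

Context d (W : measurableType d) (P : probability W R) (X : R -> W -> R).
Hypotheses (T0 : 0 < T) (levyX : levy_process P X)
  (Xf : forall t, 0 < t -> t <= T -> has_density P (X t) (f t)).

Lemma density_ge0 t x : 0 < t -> t <= T -> (0 <= f t x)%E.
Proof. by move=> t0 tT; have [_ ->] := Xf t0 tT. Qed.

Lemma measurable_density t : 0 < t -> t <= T -> measurable_fun setT (f t).
Proof. by move=> t0 tT; have [] := Xf t0 tT. Qed.

Lemma bridge_ratio_ge0 s x z : 0 <= s -> s < T -> (0 <= bridge_ratio s x z)%E.
Proof.
move=> s0 sT; apply: mule_ge0; rewrite ?inve_ge0; apply: density_ge0 => //.
  by rewrite subr_gt0.
by rewrite gerBl.
Qed.

Lemma measurable_bridge_ratio d' (S : measurableType d') s (x z : S -> R) :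
  0 <= s -> s < T -> measurable_fun setT x -> measurable_fun setT z ->
  measurable_fun setT (fun u => bridge_ratio s (x u) (z u)).
Proof.
move=> s0 sT mx mz; apply: measurable_dive.
- apply: measurableT_comp; last exact: measurable_funB.
  by apply: measurable_density; rewrite ?subr_gt0 ?gerBl.
- by apply: measurableT_comp => //; exact: measurable_density.
- by move=> u; exact: density_ge0.
Qed.

(** A subdivision of [0, T] into [N.+1] intervals. It stays monotone beyond its
    end because the independence of increments is a property of infinite
    monotone sequences of times. *)
Definition is_grid N (a : nat -> R) :=
  [/\ a 0%N = 0, {homo a : i j / (i <= j)%N >-> i <= j},
      (forall i, (i <= N)%N -> a i < a i.+1) & a N.+1 = T].

Section grid.
Variables (N : nat) (a : nat -> R).
Hypothesis grid_a : is_grid N a.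

Let a0 : a 0%N = 0. Proof. by case: grid_a. Qed.
Let a0_ge : 0 <= a 0%N. Proof. by rewrite a0. Qed.
Let a_nd : {homo a : i j / (i <= j)%N >-> i <= j}. Proof. by case: grid_a. Qed.
Let a_lt i : (i <= N)%N -> a i < a i.+1. Proof. by case: grid_a => _ _ + _; apply. Qed.
Let aT : a N.+1 = T. Proof. by case: grid_a. Qed.
Let a_ge0 i : 0 <= a i. Proof. by rewrite -a0 a_nd. Qed.
Let aN : a N < T. Proof. by rewrite -aT a_lt. Qed.

Lemma grid_path : path <%R 0 (rcons [tuple a i.+1 | i < N] T).
Proof.
have -> : rcons [tuple a i.+1 | i < N] T = map a (iota 1 N.+1).
  rewrite -[N.+1]addn1 iotaD map_cat/= add1n aT cats1; congr rcons.
  apply: (@eq_from_nth _ 0) => [|i].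
    by rewrite size_tuple ?card_ord size_map size_iota.
  rewrite size_tuple ?card_ord => iN; rewrite (nth_map 0%N) ?size_iota// nth_iota// add1n.
  by rewrite (nth_mktuple _ 0 (Ordinal iN)).
apply/(pathP 0) => i; rewrite size_map size_iota => iN.
rewrite (nth_map 0%N) ?size_iota// nth_iota// add1n.
case: i iN => [|i] iN; first by rewrite /= -{1}a0 a_lt.
rewrite -[nth _ (_ :: _) _]/(nth 0 (map a (iota 1 N.+1)) i) (nth_map 0%N) ?size_iota ?nth_iota// 1?ltnW//.
by rewrite add1n a_lt// ltnW.
Qed.

Variable x : nat -> R.

Definition path_value j i (p : R * N.-tuple R) :=
  p.1 + \sum_(j <= q < i) p.2`_q.

Lemma measurable_path_value j i : measurable_fun setT (path_value j i).
Proof.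
apply: measurable_funD => //; apply: measurable_sum => q.
exact: (measurableT_comp (@measurable_fun_nth _ N q)).
Qed.

Definition path_below j : set (R * N.-tuple R) :=
  [set p | forall i, (j <= i < N)%N -> path_value j i.+1 p <= x i].

Lemma measurable_path_below j : measurable (path_below j).
Proof.
rewrite (_ : path_below j = \bigcap_(i in [set i | (j <= i < N)%N])
    (path_value j i.+1 @^-1` `]-oo, x i]%classic)); last first.
  by apply/seteqP; split => p H i /H; rewrite /= in_itv.
apply: bigcap_measurableType => i _.
rewrite -[X in measurable X]setTI; exact: measurable_path_value.
Qed.

Definition bridge_weight z j (p : R * N.-tuple R) : \bar R :=
  ((\1_(path_below j) p)%:E * bridge_ratio (a N) (path_value j N p) z)%E.

Lemma bridge_weight_ge0 z j p : (0 <= bridge_weight z j p)%E.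
Proof. by rewrite mule_ge0 ?lee_fin// bridge_ratio_ge0. Qed.

Lemma measurable_bridge_weight z j : measurable_fun setT (bridge_weight z j).
Proof.
apply: emeasurable_funM.
  by apply/measurable_EFinP; apply: measurable_indic; exact: measurable_path_below.
apply: measurable_bridge_ratio => //.
exact: measurable_path_value.
Qed.

Local Notation incr w := [tuple increment X a i w | i < N].

Lemma measurable_increments : measurable_fun setT (fun w => incr w).
Proof. by apply: measurable_fun_mktuple => i; exact: (measurable_increment levyX a0_ge a_nd). Qed.

Lemma measurable_bridge_weight_increments z j :
  measurable_fun setT (fun p : R * W => bridge_weight z j (p.1, incr p.2)).
Proof.
apply: measurableT_comp; first exact: measurable_bridge_weight.
apply/measurable_fun_pairP; split; first exact: measurable_fst.
exact: (measurableT_comp measurable_increments measurable_snd).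
Qed.

(** Integrating out the first remaining position amounts to replacing the
    first remaining increment by an independent copy. *)
Lemma bridge_integralE z m j y0 : (j + m)%N = N ->
  bridge_integral f T z (a j) y0 [seq (a i.+1, x i) | i <- iota j m] =
  (\int[P]_w bridge_weight z j (y0, incr w))%E.
Proof.
elim: m j y0 => [|m IH] j y0 jmN.
  rewrite addn0 in jmN; subst j => /=.
  rewrite -[LHS](mule1) -(probability_setT P) -integral_cst//.
  apply: eq_integral => w _; rewrite /bridge_weight indicE mem_set/=; last first.
    by move=> i; rewrite ltnNge; case: leqP.
  by rewrite mul1e /path_value /= big_geq// addr0.
have jN : (j < N)%N by rewrite -jmN addnS ltnS leq_addr.
have dj0 : 0 < a j.+1 - a j by rewrite subr_gt0 a_lt// ltnW.
have djT : a j.+1 - a j <= T.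
  by rewrite (le_trans (y := a j.+1)) ?gerBl// -aT a_nd// ltnS ltnW.
have dens := Xf dj0 djT.
have [mf f0 _] := dens.
rewrite /= integral_indicM.
under eq_integral => y _ do rewrite (IH j.+1 y) ?addSnnS//.
rewrite (integral_shift y0); last 2 first.
- apply: emeasurable_funM; first by apply/measurable_EFinP; exact: measurable_indic.
  apply: emeasurable_funM; first by apply: measurableT_comp => //; exact: measurable_funB.
  apply: (measurable_fun_fubini_tonelli_F (m2 := P)
    (fun p : R * W => bridge_weight z j.+1 (p.1, incr p.2))) => //.
    exact: measurable_bridge_weight_increments.
  by move=> p; exact: bridge_weight_ge0.
- move=> y; rewrite !mule_ge0 ?lee_fin//.
  by apply: integral_ge0 => w _; exact: bridge_weight_ge0.
rewrite (levy_increments_resample levyX a0_ge a_nd (j := Ordinal jN) dens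
  (F := fun v => bridge_weight z j (y0, v))); last 2 first.
- apply: (measurableT_comp (measurable_bridge_weight z j)).
  apply/measurable_fun_pairP; split; first exact: measurable_cst.
  exact: measurable_id.
- by move=> v; exact: bridge_weight_ge0.
apply: eq_integral => y _; rewrite [y0 + y - y0]addrC addKr muleCA muleC.
congr (_ * _)%E.
rewrite -ge0_integralZl//; last 2 first.
- apply: measurableT_comp; first exact: measurable_bridge_weight.
  apply/measurable_fun_pairP; split; first exact: measurable_cst.
  exact: measurable_increments.
- by move=> w _; exact: bridge_weight_ge0.
apply: eq_integral => w _; rewrite /bridge_weight muleA.
set v := [tuple (if _ then _ else _) | _ < _].
have valE i : (j < i)%N -> (i <= N)%N ->
    path_value j i (y0, v) = path_value j.+1 i (y0 + y, incr w).
  move=> ji iN; rewrite /path_value /= big_ltn// addrA.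
  rewrite (nth_mktuple _ 0 (Ordinal jN)) eqxx; congr (_ + _).
  apply: eq_big_nat => q /andP[jq qi].
  have qN : (q < N)%N by rewrite (leq_trans qi).
  rewrite !(nth_mktuple _ 0 (Ordinal qN)) ifN//.
  by apply: contraTneq jq => -[->]; rewrite ltnn.
congr (_ * _)%E; last by rewrite valE.
rewrite -EFinM; congr (_%:E); rewrite !indicE -natrM mulnb; congr (_%:R).
congr nat_of_bool; apply/idP/idP.
- move=> /andP[]; rewrite !inE /= in_itv/= => yx H i /andP[ji iN].
  rewrite valE//; move: ji; rewrite leq_eqVlt => /predU1P[<-|ji].
    by rewrite /path_value /= big_geq// addr0.
  by apply: H; rewrite ji.
- rewrite inE => H; apply/andP; rewrite !inE /= in_itv/=; split.
    have := H j; rewrite leqnn jN valE// /path_value /= big_geq// addr0.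
    exact.
  move=> i /andP[ji iN]; rewrite -valE//; last exact: ltnW.
  by apply: H; rewrite iN ltnW.
Qed.

End grid.

End bridge_expectation.

(** * The law of a Levy random bridge *)

Section bridge_law.
Context {R : realType} (f : R -> R -> \bar R) (T : R) (nu : probability R R).
Context d (W : measurableType d) (P : probability W R) (X : R -> W -> R).
Hypotheses (T0 : 0 < T) (levyX : levy_process P X)
  (Xf : forall t, 0 < t -> t <= T -> has_density P (X t) (f t)).
Context d' (W' : measurableType d') (P' : probability W' R) (L : R -> W' -> R).
Hypotheses (procL : real_process `[0, T] L)
  (LT : forall B, measurable B -> P' (L T @^-1` B) = nu B)
  (Lcdf : forall (k : nat) (t x : k.+1.-tuple R), path <%R 0 (rcons t T) ->
     cond_prob_version P' [set w | forall i, L (tnth t i) w <= tnth x i]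
       (L T) (levy_bridge_cdf f T t x)).

Lemma bridge_measurable t : 0 <= t -> t <= T -> measurable_fun setT (L t).
Proof. by move=> t0 tT; have [mL _] := procL; apply: mL; rewrite /= in_itv/= t0. Qed.

Section grid.
Variables (k : nat) (a : nat -> R).
Local Notation N := k.+1.
Hypothesis grid_a : is_grid T N a.

Let a0 : a 0%N = 0. Proof. by case: grid_a. Qed.
Let a0_ge : 0 <= a 0%N. Proof. by rewrite a0. Qed.
Let a_nd : {homo a : i j / (i <= j)%N >-> i <= j}. Proof. by case: grid_a. Qed.
Let aT : a N.+1 = T. Proof. by case: grid_a. Qed.
Let a_ge0 i : 0 <= a i. Proof. by rewrite -a0 a_nd. Qed.
Let aN : a N < T. Proof. by rewrite -aT; case: grid_a => _ _ + _; apply. Qed.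
Let a_leT i : (i <= N.+1)%N -> a i <= T. Proof. by move=> iN; rewrite -aT a_nd. Qed.

Local Notation levy_path w := [tuple X (a i.+1) w - X 0 w | i < N].
Local Notation bridge_path w := [tuple L (a i.+1) w | i < N].
Local Notation ratio w z := (bridge_ratio f T (a N) (X (a N) w - X 0 w) z).

Let measurable_levy_path : measurable_fun setT (fun w => levy_path w).
Proof.
apply: measurable_fun_mktuple => i.
by apply: measurable_funB; apply: (levy_measurable levyX).
Qed.

Lemma measurable_bridge_path : measurable_fun setT (fun w => bridge_path w).
Proof.
apply: measurable_fun_mktuple => i; apply: bridge_measurable => //.
by apply: a_leT; rewrite ltnS ltnW.
Qed.

Let mratio : measurable_fun setT (fun p : W * R => ratio p.1 p.2).
Proof.
apply: (measurable_bridge_ratio (x := fun p : W * R => X (a N) p.1 - X 0 p.1)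
  (z := snd) T0 Xf) => //.
by apply: (measurableT_comp (f := fun w => X (a N) w - X 0 w)) => //;
  apply: measurable_funB; apply: (levy_measurable levyX).
Qed.

Let ratio_ge0 (p : W * R) : (0 <= ratio p.1 p.2)%E.
Proof. exact: (bridge_ratio_ge0 T0 Xf). Qed.

Let levy_point (p : W * R) := [the N.+1.-tuple R of p.2 :: levy_path p.1].
Let bridge_point (w : W') := [the N.+1.-tuple R of L T w :: bridge_path w].

Let mlevy_point : measurable_fun setT levy_point.
Proof.
apply: measurable_cons; first exact: measurable_snd.
exact: (measurableT_comp measurable_levy_path measurable_fst).
Qed.

Let mbridge_point : measurable_fun setT bridge_point.
Proof.
apply: measurable_cons; last exact: measurable_bridge_path.
by apply: bridge_measurable => //; exact: ltW.
Qed.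

Let orthant_cons (x : N.+1.-tuple R) (y : R) (v : N.-tuple R) :
  orthant x [the N.+1.-tuple R of y :: v] <->
  y <= thead x /\ forall i, tnth v i <= x`_i.+1.
Proof.
split=> [H|[H0 H] i].
  split=> [|i]; first by have := H ord0; rewrite tnth0.
  by have := H (lift ord0 i); rewrite tnthS (tnth_nth 0 x).
case: (unliftP ord0 i) => [j ->|->]; last by rewrite tnth0.
by rewrite tnthS (tnth_nth 0 x); exact: H.
Qed.

Let bridge_orthant (x : N.+1.-tuple R) :
  P' (bridge_point @^-1` orthant x) =
  (\int[nu]_(z in `]-oo, thead x]) \int[P]_w
     bridge_weight f T a (fun i => x`_i.+1) z 0
       (0%R, [tuple increment X a i w | i < N]))%E.
Proof.
have [_ Lx] := Lcdf [tuple x`_i.+1 | i < N] (grid_path grid_a).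
rewrite (_ : bridge_point @^-1` orthant x =
  [set w | forall i : 'I_N, L (tnth [tuple a i.+1 | i < N] i) w <=
     tnth [tuple x`_i.+1 | i < N] i] `&` L T @^-1` `]-oo, thead x]); last first.
  apply/seteqP; split => w.
    move=> /orthant_cons[H0 H]; split; last by rewrite /= in_itv/=.
    by move=> i; have := H i; rewrite !tnth_mktuple.
  move=> [H]; rewrite /= in_itv/= => H0; apply/orthant_cons; split => // i.
  by have := H i; rewrite !tnth_mktuple.
rewrite Lx; last exact: measurable_itv.
transitivity (\int[nu]_(z in `]-oo, thead x])
    levy_bridge_cdf f T [tuple a i.+1 | i < N] [tuple x`_i.+1 | i < N] z)%E.
  apply: eq_measure_integral => [|mLT A mA _]; last exact: LT.
  by apply: bridge_measurable => //; exact: ltW.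
apply: eq_integral => z _.
rewrite -(bridge_integralE T0 levyX Xf grid_a _ _ _ (add0n N)) a0 /levy_bridge_cdf.
congr bridge_integral; apply: (@eq_from_nth _ (0, 0)).
  by rewrite size_zip !size_tuple ?card_ord minnn.
rewrite size_zip !size_tuple ?card_ord minnn => i iN.
rewrite nth_zip ?size_tuple ?card_ord//.
rewrite (nth_map 0%N) ?size_iota// nth_iota//.
by rewrite !(nth_mktuple _ 0 (Ordinal iN)).
Qed.

Let path_belowE (x : N.+1.-tuple R) w :
  path_below (fun i => x`_i.+1) 0 (0, [tuple increment X a i w | i < N]) <->
  forall i : 'I_N, tnth (levy_path w) i <= x`_i.+1.
Proof.
have pv i : (i <= N)%N ->
    path_value 0 i (0, [tuple increment X a i w | i < N]) = X (a i) w - X 0 w.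
  move=> iN; rewrite /path_value /= add0r.
  under eq_big_nat => q /andP[_ qi].
    rewrite (nth_mktuple _ 0 (Ordinal (leq_trans qi iN)))/=. over.
  by rewrite (telescope_sumr (fun q => X (a q) w))// a0.
split=> H i; first by have := H i; rewrite ltn_ord pv// tnth_mktuple; apply.
move=> iN; rewrite pv//; have := H (Ordinal iN).
by rewrite tnth_mktuple.
Qed.

(** Conditionally on its end point, the bridge before time [T] is absolutely
    continuous with respect to the Levy process, with density the bridge ratio.
    The end point itself keeps its law [nu], which may have atoms. *)
Lemma bridge_law (F : N.-tuple R * R -> \bar R) :
  measurable_fun setT F -> (forall p, 0 <= F p)%E ->
  (\int[P']_w F (bridge_path w, L T w) =
   \int[P]_w \int[nu]_z (F (levy_path w, z) * ratio w z))%E.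
Proof.
move=> mF F0.
pose m2 : {measure set (W * R) -> \bar R} := density_measure (P \x nu)%E mratio ratio_ge0.
pose G (v : N.+1.-tuple R) := F ([tuple of behead v], thead v).
have mG : measurable_fun setT G.
  apply: measurableT_comp => //; apply/measurable_fun_pairP; split.
    exact: measurable_behead.
  exact: measurable_tnth.
have G0 v : (0 <= G v)%E by exact: F0.
have GE (y : R) (v : N.-tuple R) : G [the N.+1.-tuple R of y :: v] = F (v, y).
  by rewrite /G; congr (F (_, _)); exact: val_inj.
transitivity (\int[P']_w G (bridge_point w))%E.
  by apply: eq_integral => w _; rewrite GE.
have -> : (\int[P']_w G (bridge_point w) = \int[m2]_p G (levy_point p))%E.
  apply: (integral_law_eq mbridge_point mlevy_point) => //.
  have P'_lty : (P' setT < +oo)%E by rewrite probability_setT ltry.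
  apply: (tuple_law_unique mbridge_point mlevy_point P'_lty).
  move=> x; apply: (etrans (bridge_orthant x)); rewrite /m2/= /density_measure.
  rewrite [RHS]integral_indicM fubini_tonelli2; last 2 first.
  - apply: emeasurable_funM => //; apply/measurable_EFinP.
    apply: measurable_indic; rewrite -[X in measurable X]setTI.
    by apply: mlevy_point => //; exact: measurable_orthant.
  - by move=> p; rewrite mule_ge0 ?lee_fin.
  rewrite integral_indicM; apply: eq_integral => z _.
  rewrite -ge0_integralZl//; last 2 first.
  - apply: measurableT_comp; first exact: (measurable_bridge_weight T0 Xf grid_a).
    apply/measurable_fun_pairP; split; first exact: measurable_cst.
    exact: (measurable_increments levyX grid_a).
  - by move=> w _; exact: (bridge_weight_ge0 T0 Xf grid_a).
  apply: eq_integral => w _ /=; rewrite /bridge_weight muleA.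
  congr (_ * _)%E; last first.
    rewrite /path_value /= add0r; congr bridge_ratio.
    under eq_big_nat => q /andP[_ qN].
      rewrite (nth_mktuple _ 0 (Ordinal qN))/=. over.
    by rewrite (telescope_sumr (fun q => X (a q) w))// a0.
  rewrite -EFinM; congr (_%:E); rewrite !indicE -natrM mulnb; congr (_%:R).
  congr nat_of_bool; apply/idP/idP.
  - move=> /andP[]; rewrite !inE /= in_itv/= => zx H.
    by apply/orthant_cons; split => //; apply/path_belowE.
  - rewrite inE => /orthant_cons[zx H]; apply/andP; rewrite !inE /= in_itv/=.
    by split => //; apply/path_belowE.
rewrite (integral_density (mu := (P \x nu)%E) (nu := m2) mratio ratio_ge0)//; last first.
  exact: (measurableT_comp mG mlevy_point).
rewrite fubini_tonelli1; last 2 first.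
- by apply: emeasurable_funM => //; exact: (measurableT_comp mG mlevy_point).
- by move=> p; rewrite mule_ge0.
by apply: eq_integral => w _; apply: eq_integral => z _; rewrite GE.
Qed.

End grid.

End bridge_law.

(** * The initial value of the bridge *)

Section small_times.
Context {R : realType}.

(** A bounded continuous function that vanishes only at 0: its mean at the random
    variable [L 0] is a limit of means at small times, by dominated convergence,
    and is zero only if [L 0] is almost surely zero. *)
Definition truncated_norm (x : R) : R := Num.min `|x| 1.

Lemma truncated_norm_ge0 x : 0 <= truncated_norm x.
Proof. by rewrite /truncated_norm le_min normr_ge0 ler01. Qed.

Lemma truncated_norm_eq0 x : (truncated_norm x == 0) = (x == 0).
Proof.
rewrite /truncated_norm /Num.min; case: ifPn => [_|]; first exact: normr_eq0.
rewrite oner_eq0 => x1; apply/esym/negP => /eqP x0.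
by move: x1; rewrite x0 normr0 ltr01.
Qed.

Lemma truncated_norm_continuous : continuous truncated_norm.
Proof.
by move=> x; apply: (@continuous_min _ R (fun x => `|x|) (fun=> 1) x);
  [exact: norm_continuous|exact: cvg_cst].
Qed.

Lemma measurable_truncated_norm : measurable_fun setT truncated_norm.
Proof.
exact: (continuous_measurable_fun truncated_norm_continuous).
Qed.

Lemma cadlag_cvg_at0 (D : set R) (x : R -> R) (t : nat -> R) :
  cadlag D x -> D 0 -> (forall n, D (t n)) -> (forall n, 0 < t n) ->
  t @ \oo --> 0 -> x (t n) @[n --> \oo] --> x 0.
Proof.
move=> cx D0 Dt t0 tcvg; have [xr _] := cx 0 D0.
apply: cvg_comp xr => A [e /= e0 eA].
have small : \forall n \near \oo, ball (0 : R) e (t n).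
  exact: (tcvg _ (nbhsx_ballx 0 e e0)).
suff : \forall n \near \oo, A (t n) by [].
by apply: filterS small => n tn; apply: eA => //=; exact: t0.
Qed.

End small_times.

Section bridge_increments.
Context {R : realType} (f : R -> R -> \bar R) (T : R) (nu : probability R R).
Context d (W : measurableType d) (P : probability W R) (X : R -> W -> R).
Hypotheses (T0 : 0 < T) (levyX : levy_process P X)
  (Xf : forall t, 0 < t -> t <= T -> has_density P (X t) (f t)).
Context d' (W' : measurableType d') (P' : probability W' R) (L : R -> W' -> R).
Hypotheses (procL : real_process `[0, T] L)
  (LT : forall B, measurable B -> P' (L T @^-1` B) = nu B)
  (Lcdf : forall (k : nat) (t x : k.+1.-tuple R), path <%R 0 (rcons t T) ->
     cond_prob_version P' [set w | forall i, L (tnth t i) w <= tnth x i]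
       (L T) (levy_bridge_cdf f T t x)).

Local Notation law := (bridge_law T0 levyX Xf procL LT Lcdf).

(** The law of the bridge up to time [T / 2] has a density with respect to that
    of the Levy process, so it inherits the convergence to 0 at small times;
    right-continuity then determines the initial value. *)
Lemma bridge_initial_value : {ae P', forall w, L 0 w = 0}.
Proof.
pose s0 := T / 2.
have s00 : 0 < s0 by rewrite divr_gt0.
have s0T : s0 < T by rewrite ltr_pdivrMr// mulr_natr mulr2n ltrDl.
pose t n := s0 / 2 * @harmonic R n.
have t0 n : 0 < t n by rewrite !mulr_gt0// invr_gt0.
have ts n : t n < s0.
  apply: (@le_lt_trans _ _ (s0 / 2)).
    by rewrite ger_pMr ?divr_gt0// invf_le1// ler1n.
  by rewrite ltr_pdivrMr// mulr_natr mulr2n ltrDl.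
have tcvg : t @ \oo --> 0.
  rewrite -[X in _ --> X](mulr0 (s0 / 2)); apply: cvgMl_tmp.
  exact: cvg_harmonic.
pose a n i := match i with 0%N => 0 | 1%N => t n | 2%N => s0 | _ => T end.
have grid n : is_grid T 2 (a n).
  split=> //; last by case=> [|[|[|]]] //=.
  have step i : a n i <= a n i.+1.
    by case: i => [|[|[|i]]] /=;
      [exact: ltW (t0 n)|exact: ltW (ts n)|exact: ltW|exact: lexx].
  by apply: (homo_leq (r := <=%R)) => // x y z; exact: le_trans.
pose g (p : W * R) := bridge_ratio f T s0 (X s0 p.1 - X 0 p.1) p.2.
have mX0 s : 0 <= s -> measurable_fun setT (fun w => X s w - X 0 w).
  by move=> ?; apply: measurable_funB; apply: (levy_measurable levyX).
have mg : measurable_fun setT g.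
  apply: (measurable_bridge_ratio (x := fun p : W * R => X s0 p.1 - X 0 p.1)
    (z := snd) T0 Xf) => //; first exact: ltW.
  exact: (measurableT_comp (mX0 s0 (ltW s00)) measurable_fst).
have g0 p : (0 <= g p)%E by apply: (bridge_ratio_ge0 T0 Xf) => //; exact: ltW.
pose m2 : {measure set (W * R) -> \bar R} := density_measure (P \x nu)%E mg g0.
pose phi (x : R) := (truncated_norm x)%:E.
have mphi : measurable_fun setT phi by apply/measurable_EFinP; exact: measurable_truncated_norm.
have phi0 x : (0 <= phi x)%E by rewrite lee_fin truncated_norm_ge0.
have phi1 x : (`|phi x| <= 1)%E.
  by rewrite gee0_abs// lee_fin /truncated_norm ge_min lexx orbT.
have m2E (F : R -> \bar R) n : measurable_fun setT F -> (forall x, 0 <= F x)%E ->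
    (\int[P']_w F (L (t n) w) = \int[m2]_p F (X (t n) p.1 - X 0 p.1)%R)%E.
  move=> mF F0.
  pose G (p : 2.-tuple R * R) := F (tnth p.1 ord0).
  have mG : measurable_fun setT G.
    apply: measurableT_comp => //.
    exact: (measurableT_comp (@measurable_tnth _ _ _ _) measurable_fst).
  have mFX : measurable_fun setT (fun p : W * R => F (X (t n) p.1 - X 0 p.1)).
    apply: measurableT_comp => //.
    exact: (measurableT_comp (mX0 (t n) (ltW (t0 n))) measurable_fst).
  transitivity (\int[P']_w G ([tuple L (a n i.+1) w | i < 2], L T w))%E.
    by apply: eq_integral => w _; rewrite /G tnth_mktuple.
  rewrite (law (grid n))//; last by move=> p; exact: F0.
  rewrite (integral_density (mu := (P \x nu)%E) (nu := m2) mg g0)//.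
  have prod := fubini_tonelli1 (m1 := P) (m2 := nu)
    (fun p : W * R => F (X (t n) p.1 - X 0 p.1)%R * g p)%E
    (emeasurable_funM mFX mg) (fun p => mule_ge0 (F0 _) (g0 p)).
  apply: etrans; last exact: esym prod.
  apply: eq_integral => w _; apply: eq_integral => z _.
  by rewrite /G tnth_mktuple.
have m2T : m2 setT = 1%E.
  have := m2E (cst 1%E) 0%N (measurable_cst _) (fun=> lee01).
  rewrite (integral_cst P') // (integral_cst m2)// !mul1e => <-.
  exact: probability_setT.
have cX w : X (t n) w - X 0 w @[n --> \oo] --> 0.
  have [[_ cad] _ _ _] := levyX.
  have cXw : X (t n) w @[n --> \oo] --> X 0 w.
    apply: (cadlag_cvg_at0 (cad w)) => //=; first by rewrite in_itv/= lexx.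
    by move=> n; rewrite /= in_itv/= ltW.
  by have := cvgB cXw (cvg_cst (X 0 w)); rewrite subrr; apply.
have cL w : L (t n) w @[n --> \oo] --> L 0 w.
  have [_ cad] := procL.
  apply: (cadlag_cvg_at0 (cad w)) => //=; first by rewrite in_itv/= lexx ltW.
  by move=> n; rewrite /= in_itv/= !ltW// (lt_trans (ts n)).
have cphi x (y : R) : x @ \oo --> y -> phi (x n) @[n --> \oo] --> phi y.
  move=> xy; apply: cvg_EFin; first exact: nearW.
  exact: (cvg_comp _ _ xy (@truncated_norm_continuous R y)).
have mL s : 0 <= s -> s <= T -> measurable_fun setT (fun w => phi (L s w)).
  by move=> ? ?; apply: measurableT_comp => //; apply: (bridge_measurable procL).
have mX2 s : 0 <= s ->
    measurable_fun setT (fun p : W * R => phi (X s p.1 - X 0 p.1)).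
  move=> ?; apply: measurableT_comp => //.
  by apply: (measurableT_comp (mX0 s _) measurable_fst).
have int1 e (S : measurableType e) (m : {measure set S -> \bar R}) :
    m setT = 1%E -> m.-integrable setT (cst 1%E).
  move=> mT; apply/integrableP; split => //.
  by rewrite (eq_integral (cst 1%E)) ?integral_cst ?mT ?mul1e ?ltry// => x _; rewrite /= normr1.
have [_ _ cvgL] := @dominated_convergence _ _ R P' setT measurableT
  (fun n w => phi (L (t n) w)) (fun w => phi (L 0 w)) (cst 1%E)
  (fun n => mL _ (ltW (t0 n)) (ltW (lt_trans (ts n) s0T)))
  (mL 0 (lexx _) (ltW T0)) (aeW _ (fun w _ => cphi _ _ (cL w)))
  (int1 _ _ P' (probability_setT P')) (aeW _ (fun w n _ => phi1 _)).
have [_ _ cvgX] := @dominated_convergence _ _ R m2 setT measurableT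
  (fun n p => phi (X (t n) p.1 - X 0 p.1)) (fun=> phi 0) (cst 1%E)
  (fun n => mX2 _ (ltW (t0 n))) (measurable_cst _)
  (aeW _ (fun p _ => cphi _ _ (cX p.1))) (int1 _ _ m2 m2T)
  (aeW _ (fun p n _ => phi1 _)).
have phi00 : phi 0 = 0%E by rewrite /phi; congr (_%:E); apply/eqP; rewrite truncated_norm_eq0.
have : (\int[P']_w phi (L 0 w) = 0)%E.
  rewrite -(cvg_lim (@ereal_hausdorff R) cvgL).
  have := cvg_lim (@ereal_hausdorff R) cvgX.
  rewrite phi00 integral0 => <-; congr (limn _); apply/funext => n.
  exact: m2E.
rewrite (eq_integral (fun w => `|phi (L 0 w)|%E)); last first.
  by move=> w _; rewrite gee0_abs.
move=> /(ae_eq_integral_abs P' measurableT (mL 0 (lexx _) (ltW T0))).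
apply: filterS => w /(_ I) /= /eqP.
by rewrite /phi eqe truncated_norm_eq0 => /eqP.
Qed.

End bridge_increments.

(** * Exchangeability of the increments of the bridge *)

Section bridge_exchange.
Context {R : realType} (f : R -> R -> \bar R) (T : R) (nu : probability R R).
Context d (W : measurableType d) (P : probability W R) (X : R -> W -> R).
Hypotheses (T0 : 0 < T) (levyX : levy_process P X)
  (Xf : forall t, 0 < t -> t <= T -> has_density P (X t) (f t)).
Context d' (W' : measurableType d') (P' : probability W' R) (L : R -> W' -> R).
Hypotheses (procL : real_process `[0, T] L)
  (LT : forall B, measurable B -> P' (L T @^-1` B) = nu B)
  (Lcdf : forall (k : nat) (t x : k.+1.-tuple R), path <%R 0 (rcons t T) ->
     cond_prob_version P' [set w | forall i, L (tnth t i) w <= tnth x i]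
       (L T) (levy_bridge_cdf f T t x)).

Lemma measurable_bridge_increments k a : is_grid T k.+1 a ->
  measurable_fun setT (fun w => [tuple increment L a i w | i < k.+1]).
Proof.
move=> [a0 a_nd _ aT]; apply: measurable_fun_mktuple => i.
have ale j : (j <= k.+2)%N -> 0 <= a j <= T.
  by move=> jk; rewrite -{1}a0 -aT !a_nd.
apply: measurable_funB; apply: (bridge_measurable procL).
- by have /andP[] := ale i.+1 (leqW (ltn_ord i)).
- by have /andP[] := ale i.+1 (leqW (ltn_ord i)).
- by have /andP[] := ale i (leqW (ltnW (ltn_ord i))).
- by have /andP[] := ale i (leqW (ltnW (ltn_ord i))).
Qed.

(** Since the bridge starts at 0, its increments are a function of its later
    positions; the weight depends on the increments through their sum only. *)
Lemma bridge_increments_law k a (F : k.+1.-tuple R * R -> \bar R) :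
  is_grid T k.+1 a -> measurable_fun setT F -> (forall p, 0 <= F p)%E ->
  (\int[P']_w F ([tuple increment L a i w | i < k.+1], L T w) =
   \int[P]_w \int[nu]_z (F ([tuple increment X a i w | i < k.+1], z) *
     bridge_ratio f T (a k.+1) (\sum_(i < k.+1) increment X a i w)%R z))%E.
Proof.
move=> grid_a mF F0; have [a0 a_nd _ aT] := grid_a.
pose diffs (v : k.+1.-tuple R) : k.+1.-tuple R :=
  [tuple v`_i - (if i == 0%N :> nat then 0 else v`_i.-1) | i < k.+1].
have mdiffs : measurable_fun setT diffs.
  apply: measurable_fun_mktuple => i; apply: measurable_funB.
    exact: measurable_fun_nth.
  by case: eqP => _; [exact: measurable_cst|exact: measurable_fun_nth].
have diffsE (U : Type) (Y : R -> U -> R) (w : U) (y0 : R) : Y 0 w - y0 = 0 ->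
    diffs [tuple Y (a i.+1) w - y0 | i < k.+1] =
    [tuple increment Y a i w | i < k.+1].
  move=> Yy0; apply: eq_from_tnth => i; rewrite !tnth_mktuple /increment.
  rewrite (nth_mktuple _ 0 i); case: i => -[|i] ik /=.
    by move/eqP: Yy0; rewrite subr_eq0 => /eqP <-; rewrite a0 subr0.
  by rewrite (nth_mktuple _ 0 (Ordinal (ltnW ik)))/= opprB addrA subrK.
pose G (p : k.+1.-tuple R * R) := F (diffs p.1, p.2).
have mG : measurable_fun setT G.
  apply: measurableT_comp => //; apply/measurable_fun_pairP; split.
    exact: (measurableT_comp mdiffs measurable_fst).
  exact: measurable_snd.
transitivity (\int[P']_w G ([tuple L (a i.+1) w | i < k.+1], L T w))%E.
  apply: ge0_ae_eq_integral => //.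
  - apply: measurableT_comp => //; apply/measurable_fun_pairP; split.
      exact: measurable_bridge_increments.
    by apply: (bridge_measurable procL) => //; exact: ltW.
  - apply: measurableT_comp => //; apply/measurable_fun_pairP; split.
      exact: (measurable_bridge_path procL grid_a).
    by apply: (bridge_measurable procL) => //; exact: ltW.
  - by move=> w _; exact: F0.
  - have := bridge_initial_value T0 levyX Xf procL LT Lcdf.
    apply: filterS => w L0 _.
    rewrite /G/= -(diffsE _ L w 0) ?L0 ?subr0//; congr (F (diffs _, _)).
    by apply: eq_from_tnth => i; rewrite !tnth_mktuple subr0.
apply: (etrans (bridge_law T0 levyX Xf procL LT Lcdf grid_a mG (fun p => F0 _))).
apply: eq_integral => w _; apply: eq_integral => z _.
rewrite /G/= (diffsE _ X w (X 0 w)) ?subrr//; congr (_ * bridge_ratio _ _ _ _ _)%E.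
rewrite -(big_mkord xpredT (fun i => increment X a i w)).
by rewrite (telescope_sumr (fun i => X (a i) w))// a0.
Qed.

(** Given its end point, the law of the increments of the bridge is the law of
    the Levy increments weighted by a function of their sum; it is therefore
    unchanged when intervals of the same lengths are laid out in another order. *)
Lemma bridge_exchange k a b (s : 'I_k.+1 -> 'I_k.+1)
    (F : k.+1.-tuple R * R -> \bar R) :
  is_grid T k.+1 a -> is_grid T k.+1 b -> injective s ->
  (forall i : 'I_k.+1, a i.+1 - a i = b (s i).+1 - b (s i)) ->
  measurable_fun setT F -> (forall p, 0 <= F p)%E ->
  (\int[P']_w F ([tuple increment L a i w | i < k.+1], L T w) =
   \int[P']_w F ([tuple increment L b (s i) w | i < k.+1], L T w))%E.
Proof.
move=> grid_a grid_b s_inj ab mF F0.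
have [a0 a_nd a_lt aT] := grid_a; have [b0 b_nd _ _] := grid_b.
have abN : a k.+1 = b k.+1.
  rewrite -[LHS]subr0 -a0 -[RHS]subr0 -[X in _ = _ - X]b0.
  rewrite -!telescope_sumr// !big_mkord [RHS](reindex_inj s_inj).
  exact: eq_bigr.
pose G (p : k.+1.-tuple R * R) := F ([tuple p.1`_(s i) | i < k.+1], p.2).
have mG : measurable_fun setT G.
  apply: measurableT_comp => //; apply/measurable_fun_pairP; split; last first.
    exact: measurable_snd.
  apply: measurable_fun_mktuple => i.
  exact: (measurableT_comp (@measurable_fun_nth _ k.+1 (s i)) measurable_fst).
rewrite bridge_increments_law//.
transitivity (\int[P']_w G ([tuple increment L b i w | i < k.+1], L T w))%E;
    last first.
  apply: eq_integral => w _; congr (F (_, _)); apply: eq_from_tnth => i.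
  by rewrite !tnth_mktuple nth_mktuple.
apply: etrans; last first.
  exact/esym/(bridge_increments_law grid_b mG (fun p => F0 _)).
pose H (v : k.+1.-tuple R) := (\int[nu]_z (F (v, z) *
  bridge_ratio f T (a k.+1) (\sum_(i < k.+1) tnth v i)%R z))%E.
have aN0 : 0 <= a k.+1 by rewrite -a0 a_nd.
have aNT : a k.+1 < T by rewrite -aT a_lt.
have H0 v : (0 <= H v)%E.
  apply: integral_ge0 => z _; rewrite mule_ge0//.
  exact: (bridge_ratio_ge0 T0 Xf).
have mH : measurable_fun setT H.
  apply: (measurable_fun_fubini_tonelli_F (m2 := nu) (fun p => F p *
    bridge_ratio f T (a k.+1) (\sum_(i < k.+1) tnth p.1 i)%R p.2)%E); last first.
    by move=> p; rewrite mule_ge0//; exact: (bridge_ratio_ge0 T0 Xf).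
  apply: emeasurable_funM => //.
  apply: (measurable_bridge_ratio
    (x := fun p : k.+1.-tuple R * R => \sum_(i < k.+1) tnth p.1 i)
    (z := snd) T0 Xf) => //.
  apply: measurable_sum => i.
  exact: (measurableT_comp (@measurable_tnth _ _ _ i) measurable_fst).
transitivity (\int[P]_w H [tuple increment X a i w | i < k.+1])%E.
  apply: eq_integral => w _; apply: eq_integral => z _.
  by under [in RHS]eq_bigr do rewrite tnth_mktuple.
have a0_ge : 0 <= a 0%N by rewrite a0.
have b0_ge : 0 <= b 0%N by rewrite b0.
apply: (etrans (levy_increments_permute levyX a0_ge a_nd b0_ge b_nd s_inj ab mH H0)).
apply: eq_integral => w _; apply: eq_integral => z _; rewrite /G /=.
congr (F (_, _) * _)%E.
  by apply: eq_from_tnth => i; rewrite !tnth_mktuple nth_mktuple.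
rewrite abN; congr bridge_ratio; under eq_bigr do rewrite tnth_mktuple.
by rewrite [RHS](reindex_inj s_inj).
Qed.

End bridge_exchange.

(** * Two subdivisions with the same interval lengths *)

Section glp_grids.
Context {R : realType} (n : nat) (m : n.-tuple R).
Hypotheses (n2 : (2 <= n)%N) (m0 : forall i, 0 < tnth m i).

Local Notation c := (usum m n).

Lemma usum0 : usum m 0 = 0. Proof. exact: big_ord0. Qed.

Lemma usumS i : usum m i.+1 = usum m i + m`_i.
Proof. exact: big_ord_recr. Qed.

Lemma activity_ge0 i : 0 <= m`_i.
Proof.
have [ni|ni] := ltnP i n; last by rewrite nth_default ?size_tuple.
by have := m0 (Ordinal ni); rewrite (tnth_nth 0) => /ltW.
Qed.

Lemma activity_gt0 i : (i < n)%N -> 0 < m`_i.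
Proof. by move=> ni; have := m0 (Ordinal ni); rewrite (tnth_nth 0). Qed.

Lemma usum_gt0 : 0 < c.
Proof.
have n0 : (0 < n)%N by rewrite ltnW.
rewrite /usum (bigD1 (Ordinal n0))//= ltr_pwDl ?activity_gt0//.
by apply: sumr_ge0 => i _; exact: activity_ge0.
Qed.

Lemma ones_dot_usum : ones_dot m = c.
Proof. by apply: eq_bigr => i _; rewrite (tnth_nth 0). Qed.

Variables (k : nat) (s : nat -> R).
Local Notation K := k.+2.
Hypothesis grid_s : is_grid 1 k.+1 s.

Let s0 : s 0%N = 0. Proof. by case: grid_s. Qed.
Let s_nd : {homo s : i j / (i <= j)%N >-> i <= j}. Proof. by case: grid_s. Qed.
Let s_lt j : (j < K)%N -> s j < s j.+1. Proof. by case: grid_s => _ _ + _; apply. Qed.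
Let s1 : s K = 1. Proof. by case: grid_s. Qed.

(** The times [s_j m_i + u_i], which run through the coordinates one after the
    other, and the same interval lengths laid out so that all coordinates
    advance from [s_j] to [s_(j+1)] before any of them goes further. *)
Definition coordinate_grid (q : nat) : R :=
  s (q %% K)%N * m`_(q %/ K)%N + usum m (q %/ K)%N.

Definition time_grid (q : nat) : R :=
  c * s (q %/ n)%N + (s (q %/ n).+1 - s (q %/ n)%N) * usum m (q %% n)%N.

Lemma coordinate_gridE i j : (j <= K)%N ->
  coordinate_grid (i * K + j) = s j * m`_i + usum m i.
Proof.
rewrite leq_eqVlt => /predU1P[->|jK]; last first.
  by rewrite /coordinate_grid divnMDl// modnMDl divn_small// modn_small// addn0.
rewrite /coordinate_grid -mulSnr mulnK// modnMl s0 mul0r add0r s1 mul1r usumS.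
by rewrite addrC.
Qed.

Lemma time_gridE j i : (i <= n)%N ->
  time_grid (j * n + i) = c * s j + (s j.+1 - s j) * usum m i.
Proof.
have n0 : (0 < n)%N by rewrite ltnW.
rewrite leq_eqVlt => /predU1P[->|ni]; last first.
  by rewrite /time_grid divnMDl// modnMDl divn_small// modn_small// addn0.
rewrite /time_grid -mulSnr mulnK// modnMl usum0 mulr0 addr0.
by rewrite [(_ - _) * _]mulrC -mulrDr addrC subrK.
Qed.

Lemma coordinate_grid_step q : coordinate_grid q.+1 - coordinate_grid q =
  (s (q %% K).+1 - s (q %% K)%N) * m`_(q %/ K)%N.
Proof.
have jK : (q %% K < K)%N by rewrite ltn_mod.
rewrite {1 2}(divn_eq q K) -addnS !coordinate_gridE//; last exact: ltnW.
by rewrite opprD addrACA subrr addr0 mulrBl.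
Qed.

Lemma time_grid_step q : time_grid q.+1 - time_grid q =
  (s (q %/ n).+1 - s (q %/ n)%N) * m`_(q %% n)%N.
Proof.
have qn : (q %% n < n)%N by rewrite ltn_mod ltnW.
rewrite {1 2}(divn_eq q n) -addnS !time_gridE//; last exact: ltnW.
by rewrite opprD addrACA subrr add0r -mulrBr usumS [usum _ _ + _]addrC addrK.
Qed.

Lemma is_grid_of_steps N T (a : nat -> R) : a 0%N = 0 -> a N.+1 = T ->
  (forall q, 0 <= a q.+1 - a q) ->
  (forall q, (q < N.+1)%N -> 0 < a q.+1 - a q) -> is_grid T N a.
Proof.
move=> a0 aT a_nd a_lt; split => // [|q qN]; last by rewrite -subr_gt0 a_lt.
apply: (homo_leq (r := <=%R)) => // [x y z|q]; first exact: le_trans.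
by rewrite -subr_ge0.
Qed.

Local Notation N := (n * K).-2.+1.

Lemma grid_size : N.+1 = (n * K)%N.
Proof. by move: n2; case: (n) => [|[|n']]// _; rewrite !mulSn. Qed.

Lemma grid_size_lt (q : 'I_N) : (q < n * K)%N.
Proof. by rewrite -[X in (_ < X)%N]grid_size ltnS ltnW. Qed.

Lemma coordinate_grid_is_grid : is_grid c N coordinate_grid.
Proof.
apply: is_grid_of_steps => [||q|q].
- by rewrite -[0%N]/(0 * K + 0)%N coordinate_gridE// s0 mul0r add0r usum0.
- rewrite grid_size -[(n * K)%N]addn0 coordinate_gridE// s0 mul0r add0r.
  by [].
- by rewrite coordinate_grid_step mulr_ge0 ?activity_ge0// subr_ge0 s_nd.
- rewrite grid_size => qnK; rewrite coordinate_grid_step mulr_gt0//.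
    by rewrite subr_gt0 s_lt// ltn_mod.
  by rewrite activity_gt0// ltn_divLR.
Qed.

Lemma time_grid_is_grid : is_grid c N time_grid.
Proof.
have n0 : (0 < n)%N by rewrite ltnW.
apply: is_grid_of_steps => [||q|q].
- by rewrite -[0%N]/(0 * n + 0)%N time_gridE// s0 mulr0 add0r usum0 mulr0.
- by rewrite grid_size mulnC -[(K * n)%N]addn0 time_gridE// s1 mulr1 usum0 mulr0 addr0.
- by rewrite time_grid_step mulr_ge0 ?activity_ge0// subr_ge0 s_nd.
- rewrite grid_size => qnK; rewrite time_grid_step mulr_gt0//.
    by rewrite subr_gt0 s_lt// ltn_divLR// mulnC.
  by rewrite activity_gt0// ltn_mod.
Qed.

Definition transpose_index (q : nat) : nat := (q %% K * n + q %/ K)%N.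

Lemma transpose_indexK q : (q < n * K)%N ->
  (transpose_index q %/ n = q %% K)%N /\ (transpose_index q %% n = q %/ K)%N.
Proof.
move=> qnK; have qn : (q %/ K < n)%N by rewrite ltn_divLR.
have n0 : (0 < n)%N by rewrite ltnW.
by rewrite /transpose_index divnMDl// modnMDl (divn_small qn) (modn_small qn) addn0.
Qed.

Lemma transpose_index_inj p q : (p < n * K)%N -> (q < n * K)%N ->
  transpose_index p = transpose_index q -> p = q.
Proof.
move=> pnK qnK pq; have [p1 p2] := transpose_indexK pnK.
have [q1 q2] := transpose_indexK qnK.
by rewrite (divn_eq p K) -p1 -p2 pq q1 q2 -divn_eq.
Qed.

(** Exchangeability leaves out the last interval, at whose end the bridge is
    pinned. The transposition respects this: the last interval is that of the
    last coordinate over the last time step in both layouts. *)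
Lemma transpose_index_bound (q : 'I_N) : (transpose_index q < N)%N.
Proof.
have n0 : (0 < n)%N by rewrite ltnW.
have qN := grid_size_lt q.
have lastK : transpose_index N = N.
  have NE : N = (n.-1 * K + k.+1)%N.
    apply: succn_inj; rewrite grid_size -addnS -[in LHS](prednK n0).
    by rewrite mulSn addnC.
  have [Nd Nm] : (N %/ K)%N = n.-1 /\ (N %% K)%N = k.+1.
    by rewrite NE divnMDl// modnMDl divn_small// modn_small// addn0.
  rewrite /transpose_index Nd Nm; apply: succn_inj; rewrite grid_size.
  by rewrite -addnS prednK// -mulSnr mulnC.
have tq : (transpose_index q < N.+1)%N.
  rewrite grid_size /transpose_index.
  apply: (@leq_trans (q %% K * n + n)).
    by rewrite ltn_add2l ltn_divLR.
  by rewrite -mulSnr mulnC leq_mul2l ltn_mod orbT.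
move: tq; rewrite ltnS leq_eqVlt => /predU1P[tqN|//].
have : nat_of_ord q = N.
  by apply: transpose_index_inj; rewrite ?lastK// -[X in (_ < X)%N]grid_size.
by have := ltn_ord q => /[swap] ->; rewrite ltnn.
Qed.

Definition transpose (q : 'I_N) : 'I_N := Ordinal (transpose_index_bound q).

Lemma transpose_inj : injective transpose.
Proof.
move=> p q /(congr1 val)/= pq; apply: val_inj => /=.
by apply: transpose_index_inj pq; exact: grid_size_lt.
Qed.

Lemma transpose_step (q : 'I_N) :
  coordinate_grid q.+1 - coordinate_grid q =
  time_grid (transpose q).+1 - time_grid (transpose q).
Proof.
have qN := grid_size_lt q.
rewrite coordinate_grid_step time_grid_step /=.
by have [-> ->] := transpose_indexK qN.
Qed.

End glp_grids.

(** * From the Liouville process to a single bridge path *)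

Section glp_law.
Context {R : realType} (n : nat) (m : n.-tuple R).
Hypotheses (n2 : (2 <= n)%N) (m0 : forall i, 0 < tnth m i).
Local Notation c := (usum m n).

Context (f : R -> R -> \bar R) (nu : probability R R).
Context d (W : measurableType d) (P : probability W R) (X : R -> W -> R).
Hypotheses (levyX : levy_process P X)
  (Xf : forall t, 0 < t -> t <= c -> has_density P (X t) (f t)).
Context d' (W' : measurableType d') (P' : probability W' R) (L : R -> W' -> R).
Hypotheses (procL : real_process `[0, c] L)
  (LT : forall B, measurable B -> P' (L c @^-1` B) = nu B)
  (Lcdf : forall (k : nat) (t x : k.+1.-tuple R), path <%R 0 (rcons t c) ->
     cond_prob_version P' [set w | forall i, L (tnth t i) w <= tnth x i]
       (L c) (levy_bridge_cdf f c t x)).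

Variables (k : nat) (s : nat -> R).
Local Notation K := k.+2.
Hypothesis grid_s : is_grid 1 k.+1 s.
Local Notation N := (n * K).-2.+1.
Local Notation a := (coordinate_grid m k s).
Local Notation b := (time_grid m s).

Let s0 : s 0%N = 0. Proof. by case: grid_s. Qed.
Let sle i : (i <= K)%N -> 0 <= s i <= 1.
Proof. by have [<- s_nd _ <-] := grid_s; move=> iK; rewrite !s_nd. Qed.

(** What the increments listed along [coordinate_grid] say about the value of
    coordinate [i] at time [s j]. *)
Definition coordinate_value j i (v : N.-tuple R) : R :=
  \sum_(j' < j) v`_(i * K + j').

Lemma measurable_coordinate_value j i :
  measurable_fun setT (coordinate_value j i).
Proof. by apply: measurable_sum => j'; exact: measurable_fun_nth. Qed.

Let index_bound i j : (i < n)%N -> (j.+1 < K)%N -> (i * K + j < N)%N.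
Proof.
move=> ni jK; rewrite -ltnS [X in (_ < X)%N](grid_size n2 k).
by rewrite -addnS (@leq_trans (i * K + K))// ?ltn_add2l// -mulSnr leq_mul2r ni orbT.
Qed.

Lemma coordinate_value_coordinate w j i : (j < K)%N -> (i < n)%N ->
  coordinate_value j i [tuple increment L a q w | q < N] =
  L (s j * m`_i + usum m i) w - L (usum m i) w.
Proof.
move=> jK ni; rewrite /coordinate_value.
under eq_bigr => j' _.
  have jN := index_bound ni (leq_ltn_trans (ltn_ord j') jK).
  rewrite (nth_mktuple _ 0 (Ordinal jN))/= /increment -addnS; over.
rewrite -(big_mkord xpredT (fun q => L (a (i * K + q.+1)%N) w - L (a (i * K + q)%N) w)).
rewrite (telescope_sumr (fun q => L (a (i * K + q)%N) w))//.
rewrite !(coordinate_gridE m grid_s)//; last exact: ltnW.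
by rewrite s0 mul0r add0r.
Qed.

Lemma coordinate_value_time w j i : (j < K)%N -> (i < n)%N ->
  coordinate_value j i
    [tuple increment L b (transpose n2 (k := k) q) w | q < N] =
  \sum_(j' < j) increment L b (j' * n + i) w.
Proof.
move=> jK ni; apply: eq_bigr => j' _.
have j'K : (j'.+1 < K)%N by rewrite (leq_ltn_trans (ltn_ord j')).
rewrite (nth_mktuple _ 0 (Ordinal (index_bound ni j'K)))/=.
congr (increment L b _ w); rewrite /transpose_index.
by rewrite divnMDl// modnMDl (divn_small (ltnW j'K)) (modn_small (ltnW j'K)) addn0.
Qed.

Lemma sum_coordinate_value_time w j : (j < K)%N ->
  \sum_(i < n) coordinate_value j i
    [tuple increment L b (transpose n2 (k := k) q) w | q < N] =
  L (c * s j) w - L 0 w.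
Proof.
move=> jK; have n0 : (0 < n)%N by rewrite ltnW.
under eq_bigr do rewrite coordinate_value_time//.
have bn j' : b (j' * n)%N = c * s j'.
  by rewrite -[(j' * n)%N]addn0 time_gridE// usum0 mulr0 addr0.
rewrite exchange_big/=; transitivity
  (\sum_(j' < j) (L (c * s j'.+1) w - L (c * s j') w)).
  apply: eq_bigr => j' _; rewrite -!bn.
  rewrite -(big_mkord xpredT (fun i => increment L b (j' * n + i) w)).
  rewrite mulSnr -[in X in _ - L X w](addn0 (j' * n)%N).
  rewrite -(telescope_sumr (fun i => L (b (j' * n + i)%N) w))//.
  by apply: eq_big_nat => i _; rewrite /increment addnS.
rewrite -(big_mkord xpredT (fun i => L (c * s i.+1) w - L (c * s i) w)).
by rewrite (telescope_sumr (fun i => L (c * s i) w))// s0 mulr0.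
Qed.

Local Notation glp t w := (GLP_of_LRB m L t w).

(** Up to a reordering of the intervals, the coordinates of the Liouville
    process over a time step are consecutive increments of the bridge, and
    their total is the increment of the bridge over the whole block. *)
Lemma glp_law (G : n.-tuple R * k.+1.-tuple R * R -> \bar R) :
  measurable_fun setT G -> (forall p, 0 <= G p)%E ->
  (\int[P']_w G (glp (s 1%N) w,
     [tuple ones_dot (glp (s j.+1) w) | j < k.+1], L c w) =
   \int[P']_w G ([tuple increment L b i w | i < n],
     [tuple L (c * s j.+1)%R w | j < k.+1], L c w))%E.
Proof.
move=> mG G0; have c0 := usum_gt0 n2 m0.
pose blocks (v : N.-tuple R) : n.-tuple R * k.+1.-tuple R :=
  ([tuple coordinate_value 1 i v | i < n],
   [tuple \sum_(i < n) coordinate_value j.+1 i v | j < k.+1]).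
have mblocks : measurable_fun setT blocks.
  apply/measurable_fun_pairP; split; apply: measurable_fun_mktuple => j.
    exact: measurable_coordinate_value.
  by apply: measurable_sum => i; exact: measurable_coordinate_value.
pose F (p : N.-tuple R * R) := G (blocks p.1, p.2).
have mF : measurable_fun setT F.
  apply: measurableT_comp => //; apply/measurable_fun_pairP; split.
    exact: (measurableT_comp mblocks measurable_fst).
  exact: measurable_snd.
have jK (j : 'I_k.+1) : (j.+1 < K)%N by have := ltn_ord j.
have grid_a := coordinate_grid_is_grid n2 m0 grid_s.
have grid_b := time_grid_is_grid n2 m0 grid_s.
transitivity (\int[P']_w F ([tuple increment L a q w | q < N], L c w))%E.
  apply: eq_integral => w _; rewrite /F/=; congr (G (_, _, _)).
    apply: eq_from_tnth => i; rewrite !tnth_mktuple coordinate_value_coordinate//.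
    by rewrite (tnth_nth 0).
  apply: eq_from_tnth => j; rewrite !tnth_mktuple; apply: eq_bigr => i _.
  rewrite tnth_mktuple coordinate_value_coordinate ?jK//.
  by rewrite (tnth_nth 0).
apply: (etrans (bridge_exchange c0 levyX Xf procL LT Lcdf grid_a grid_b
  (@transpose_inj _ n2 k) (transpose_step m n2 grid_s) mF (fun p => G0 _))).
have mLc j : (j <= K)%N -> measurable_fun setT (L (c * s j)).
  move=> /sle /andP[s0j s1j].
  apply: (bridge_measurable procL); first by rewrite mulr_ge0// ltW.
  by rewrite ger_pMr.
have mLcc : measurable_fun setT (L c).
  by apply: (bridge_measurable procL) => //; exact: ltW.
have mincr q : (q < N)%N -> measurable_fun setT (increment L b q).
  move=> qN; have [b0 b_nd _ bT] := grid_b.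
  have mLb i : (i <= N.+1)%N -> measurable_fun setT (L (b i)).
    move=> iN; apply: (bridge_measurable procL); first by rewrite -b0 b_nd.
    by rewrite -bT b_nd.
  by apply: measurable_funB; apply: mLb; rewrite leqW// ltnW.
have iN (i : 'I_n) : (i < N)%N.
  have := index_bound (j := 0) (ltn_ord i) isT.
  by apply: leq_ltn_trans; rewrite addn0 leq_pmulr.
apply: ge0_ae_eq_integral => //.
- apply: (measurableT_comp mF); apply/measurable_fun_pairP; split => //.
  by apply: measurable_fun_mktuple => i; exact: mincr.
- apply: (measurableT_comp mG); apply/measurable_fun_pairP; split => //.
  apply/measurable_fun_pairP; split; apply: measurable_fun_mktuple => i.
    exact: mincr.
  by apply: mLc; rewrite ltnW// ltnS.
- by move=> w _; exact: G0.
have := bridge_initial_value c0 levyX Xf procL LT Lcdf.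
apply: filterS => w L0 _; rewrite /F/=; congr (G (_, _, _)).
  apply: eq_from_tnth => i; rewrite !tnth_mktuple coordinate_value_time//.
  by rewrite big_ord1 mul0n add0n.
apply: eq_from_tnth => j; rewrite !tnth_mktuple sum_coordinate_value_time ?jK//.
by rewrite L0 subr0.
Qed.

End glp_law.

(** * Conditional laws from disintegrations *)

Section conditional_law.
Local Open Scope ereal_scope.
Context {R : realType} d (W : measurableType d) (P : probability W R).
Context d' (S : measurableType d') (Y : W -> S) (Z : W -> R).
Hypotheses (mY : measurable_fun setT Y) (mZ : measurable_fun setT Z).
Variables (mu : {measure set S -> \bar R}) (w : S -> \bar R)
  (K : S -> {measure set R -> \bar R}) (kappa : S -> set R -> \bar R).
Hypotheses (mw : measurable_fun setT w) (w0 : forall x, 0 <= w x).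
Hypothesis Kw : {ae mu, forall x, K x setT = w x}.
Hypothesis mK : forall B, measurable B -> measurable_fun setT (fun x => K x B).
Hypothesis joint : forall C B, measurable C -> measurable B ->
  P (Y @^-1` C `&` Z @^-1` B) = \int[mu]_(x in C) K x B.
Hypothesis mkappa : forall B, measurable B -> measurable_fun setT (kappa ^~ B).
Hypothesis kappa0 : forall x B, 0 <= kappa x B.
Hypothesis kappaE : forall x B, measurable B -> 0 < w x -> w x < +oo ->
  kappa x B = K x B / w x.

Lemma law_of_weight C : measurable C -> P (Y @^-1` C) = \int[mu]_(x in C) w x.
Proof.
move=> mC; have := joint mC measurableT; rewrite preimage_setT setIT => ->.
apply: ge0_ae_eq_integral => //; [exact: measurable_funTS (mK measurableT)
  |exact: measurable_funTS|].
by apply: filterS Kw => x + _.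
Qed.

Let good : {ae mu, forall x, K x setT = w x /\ w x < +oo}.
Proof.
have wint : mu.-integrable setT w.
  apply/integrableP; split => //.
  rewrite (eq_integral w) => [|x _]; last by rewrite gee0_abs.
  by rewrite -law_of_weight// preimage_setT probability_setT ltry.
apply: filterS2 Kw (integrable_ae measurableT wint) => x Kx /(_ I) wfin.
by split => //; rewrite -ge0_fin_numE.
Qed.

(** If the law of the conditioning variable has density [w] with respect to
    [mu], and the joint law disintegrates over [mu] with kernel [K], then [K]
    divided by its mass [w] is the conditional law: the points where [w]
    vanishes or is infinite are null for the conditioning variable. *)
Lemma cond_law_of_kernel : cond_law_version P Z Y kappa.
Proof.
split.
  have [N [mN N0 Ngood]] := good.
  have m0 : measurable (w @^-1` [set 0]).
    by rewrite -[X in measurable X]setTI; apply: mw => //; exact: emeasurable_set1.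
  exists (N `|` w @^-1` [set 0]); split.
  - exact: measurableU.
  - apply/eqP; rewrite eq_le /pushforward measure_ge0 andbT law_of_weight; last first.
      exact: measurableU.
    rewrite (ge0_negligible_integral mN)//; last 2 first.
      exact: measurableU.
      exact: measurable_funTS.
    rewrite integral0_eq// => x [[]// wx0 _]; exact: wx0.
  - move=> x; apply: contra_notP => /not_orP[xN wx0].
    have [Kx wxy] : K x setT = w x /\ w x < +oo.
      by apply: contrapT => bad; apply: xN; apply: Ngood.
    have wxgt0 : 0 < w x by rewrite lt0e w0 andbT; apply/eqP.
    exists (mnormalize (K x) \d_(0%R : R)) => B mB.
    rewrite kappaE// /= /mnormalize Kx gt_eqF//= lt_eqF//.
    rewrite -[in LHS](@fineK _ (w x)) ?ge0_fin_numE// inver fine_eq0 ?gt_eqF//.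
    by rewrite ge0_fin_numE.
move=> B mB; split; first exact: mkappa.
move=> C mC; rewrite setIC joint//.
pose nu : {measure set S -> \bar R} :=
  image_measure P mY.
rewrite [RHS](integral_indicM nu).
have mCk : measurable_fun setT (fun x => (\1_C x)%:E * kappa x B).
  apply: emeasurable_funM; last exact: mkappa.
  by apply/measurable_EFinP; exact: measurable_indic.
have Ck0 x : 0 <= (\1_C x)%:E * kappa x B by rewrite mule_ge0 ?lee_fin.
rewrite (@integral_density _ _ R mu nu w mw w0 law_of_weight _ mCk Ck0).
rewrite integral_indicM; apply: ge0_ae_eq_integral => //.
- apply: emeasurable_funM; last exact: mK.
  by apply/measurable_EFinP; exact: measurable_indic.
- exact: emeasurable_funM.
- by move=> x _; rewrite mule_ge0 ?lee_fin.
apply: filterS good => x [Kx wxy] _; rewrite -muleA; congr (_ * _).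
have [wx0|wx0] := eqVneq (w x) 0; last first.
  have wxgt0 : 0 < w x by rewrite lt0e wx0 w0.
  by rewrite kappaE// -muleA mulVe ?mule1// ge0_fin_numE.
rewrite wx0 mule0; apply/eqP; rewrite eq_le measure_ge0 andbT -wx0 -Kx.
by apply: le_measure; rewrite ?inE.
Qed.

End conditional_law.

(** * Transitions of the bridge *)

Section bridge_transitions.
Context {R : realType} (f : R -> R -> \bar R) (T : R) (nu : probability R R).
Context d (W : measurableType d) (P : probability W R) (X : R -> W -> R).
Hypotheses (T0 : 0 < T) (levyX : levy_process P X)
  (Xf : forall t, 0 < t -> t <= T -> has_density P (X t) (f t)).
Context d' (W' : measurableType d') (P' : probability W' R) (L : R -> W' -> R).
Hypotheses (procL : real_process `[0, T] L)
  (LT : forall B, measurable B -> P' (L T @^-1` B) = nu B)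
  (Lcdf : forall (k : nat) (t x : k.+1.-tuple R), path <%R 0 (rcons t T) ->
     cond_prob_version P' [set w | forall i, L (tnth t i) w <= tnth x i]
       (L T) (levy_bridge_cdf f T t x)).

(** The density at [x] of the bridge at time [t], relative to the law of the
    Levy process at that time. *)
Definition bridge_mass (t x : R) : \bar R := (\int[nu]_z bridge_ratio f T t x z)%E.

Lemma bridge_mass_ge0 t x : 0 <= t -> t < T -> (0 <= bridge_mass t x)%E.
Proof.
by move=> t0 tT; apply: integral_ge0 => z _; exact: (bridge_ratio_ge0 T0 Xf).
Qed.

Lemma measurable_bridge_kernel d1 (S : measurableType d1) (x : S -> R) t B :
  0 <= t -> t < T -> measurable_fun setT x -> measurable B ->
  measurable_fun setT (fun u => \int[nu]_(z in B) bridge_ratio f T t (x u) z)%E.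
Proof.
move=> t0 tT mx mB; under eq_fun do rewrite integral_indicM.
apply: (measurable_fun_fubini_tonelli_F (m2 := nu)
  (fun p : S * R => (\1_B p.2)%:E * bridge_ratio f T t (x p.1) p.2)%E).
  apply: emeasurable_funM.
    apply/measurable_EFinP; apply: measurableT_comp => //.
  apply: (measurable_bridge_ratio (x := fun p : S * R => x p.1) (z := snd) T0 Xf)
    => //.
  exact: (measurableT_comp mx measurable_fst).
by move=> p; rewrite mule_ge0 ?lee_fin//; exact: (bridge_ratio_ge0 T0 Xf).
Qed.

Lemma measurable_bridge_mass t : 0 <= t -> t < T ->
  measurable_fun setT (bridge_mass t).
Proof.
by move=> t0 tT; exact: (measurable_bridge_kernel t0 tT (@measurable_id _ _ _)).
Qed.

Section transition.
Variables (p : nat) (a : nat -> R).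
Hypothesis grid_a : is_grid T p.+1 a.

Let a0 : a 0%N = 0. Proof. by case: grid_a. Qed.
Let a0_ge : 0 <= a 0%N. Proof. by rewrite a0. Qed.
Let a_nd : {homo a : i j / (i <= j)%N >-> i <= j}. Proof. by case: grid_a. Qed.
Let aT : a p.+2 = T. Proof. by case: grid_a. Qed.
Let a_lt i : (i <= p.+1)%N -> a i < a i.+1. Proof. by case: grid_a => _ _ + _; apply. Qed.
Let a_ge0 i : 0 <= a i. Proof. by rewrite -a0 a_nd. Qed.
Let aN : a p.+1 < T. Proof. by rewrite -aT a_lt. Qed.

Lemma measurable_levy_increments q :
  measurable_fun setT (fun w => [tuple increment X a i w | i < q]).
Proof.
by apply: measurable_fun_mktuple => i; exact: (measurable_increment levyX a0_ge a_nd).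
Qed.

Let sumT q (v : q.-tuple R) : R := \sum_(i < q) tnth v i.

Let measurable_sumT q : measurable_fun setT (@sumT q).
Proof. by apply: measurable_sum => i; exact: measurable_tnth. Qed.

Lemma bridge_block_law (C : set (p.+1.-tuple R)) B :
  measurable C -> measurable B ->
  P' ((fun w => [tuple increment L a i w | i < p.+1]) @^-1` C `&` L T @^-1` B) =
  (\int[pushforward P (fun w => [tuple increment X a i w | i < p.+1])]_(x in C)
     \int[nu]_(z in B) bridge_ratio f T (a p.+1) (\sum_(i < p.+1) tnth x i)%R z)%E.
Proof.
move=> mC mB; set A := _ `&` _.
have mA : measurable A.
  apply: measurableI; rewrite -[X in measurable X]setTI.
    exact: (measurable_bridge_increments procL grid_a).
  by apply: (bridge_measurable procL) => //; exact: ltW.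
pose F (u : p.+1.-tuple R * R) : \bar R := ((\1_C u.1)%:E * (\1_B u.2)%:E)%E.
have mF : measurable_fun setT F.
  apply: emeasurable_funM; apply/measurable_EFinP;
    by apply: measurableT_comp => //; exact: measurable_indic.
have F0 u : (0 <= F u)%E by rewrite mule_ge0 ?lee_fin.
have -> : P' A = (\int[P']_w F ([tuple increment L a i w | i < p.+1], L T w))%E.
  rewrite -[X in P' X](setIT A) -integral_indic//; apply: eq_integral => w _.
  by rewrite /F /A indicI EFinM.
apply: (etrans (bridge_increments_law T0 levyX Xf procL LT Lcdf grid_a mF F0)).
have mK : measurable_fun setT (fun x : p.+1.-tuple R =>
    \int[nu]_(z in B) bridge_ratio f T (a p.+1) (sumT x) z)%E.
  exact: (measurable_bridge_kernel (a_ge0 _) aN (@measurable_sumT p.+1) mB).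
have K0 (x : p.+1.-tuple R) : (0 <= \int[nu]_(z in B) bridge_ratio f T (a p.+1) (sumT x) z)%E.
  by apply: integral_ge0 => z _; exact: (bridge_ratio_ge0 T0 Xf).
rewrite (ge0_integral_pushforward (@measurable_levy_increments p.+1) P mC
  (measurable_funTS mK) (fun x _ => K0 x)).
rewrite [RHS]integral_indicM; apply: eq_integral => w _ /=.
rewrite [in RHS]integral_indicM -ge0_integralZl//; last 2 first.
- apply: emeasurable_funM; first exact: measurable_EFin_indic.
  by apply: (measurable_bridge_ratio T0 Xf) => //; exact: measurable_cst.
- by move=> z _; rewrite mule_ge0 ?lee_fin//; exact: (bridge_ratio_ge0 T0 Xf).
apply: eq_integral => z _; rewrite /F /= -muleA; congr (_ * (_ * _))%E.
by congr bridge_ratio; apply: eq_bigr => i _; rewrite tnth_mktuple.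
Qed.

(** The increment following a block of increments is independent of the block,
    and its density is that of the Levy process. *)
Lemma bridge_transition (C : set (p.-tuple R)) B :
  measurable C -> measurable B ->
  P' ((fun w => [tuple increment L a i w | i < p]) @^-1` C `&`
      L (a p.+1) @^-1` B) =
  (\int[pushforward P (fun w => [tuple increment X a i w | i < p])]_(x in C)
     \int[lebesgue_measure]_(y in B) (bridge_mass (a p.+1) y *
       f (a p.+1 - a p)%R (y - \sum_(i < p) tnth x i)%R))%E.
Proof.
move=> mC mB; set A := _ `&` _.
have L1 : measurable_fun setT (fun w => [tuple increment L a i w | i < p.+1]).
  exact: (measurable_bridge_increments procL grid_a).
pose init (v : p.+1.-tuple R) : p.-tuple R := [tuple v`_i | i < p].
have minit : measurable_fun setT init.
  by apply: measurable_fun_mktuple => i; exact: measurable_fun_nth.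
have initE (U : Type) (Y : nat -> U -> R) w :
    init [tuple Y i w | i < p.+1] = [tuple Y i w | i < p].
  apply: eq_from_tnth => i; rewrite !tnth_mktuple.
  by rewrite (nth_mktuple _ 0 (widen_ord (leqnSn p) i)).
have mA : measurable A.
  apply: measurableI; rewrite -[X in measurable X]setTI.
    have := measurableT_comp minit L1.
    rewrite (_ : _ \o _ = fun w => [tuple increment L a i w | i < p]); last first.
      by apply/funext => w; rewrite /= initE.
    exact.
  by apply: (bridge_measurable procL) => //; exact: ltW.
pose F (u : p.+1.-tuple R * R) : \bar R :=
  ((\1_C (init u.1))%:E * (\1_B (sumT u.1))%:E)%E.
have mI1 : measurable_fun setT (fun v : p.+1.-tuple R => (\1_C (init v))%:E : \bar R).
  exact: (measurableT_comp (measurable_EFin_indic mC) minit).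
have mI2 : measurable_fun setT (fun v : p.+1.-tuple R => (\1_B (sumT v))%:E : \bar R).
  exact: (measurableT_comp (measurable_EFin_indic mB) (@measurable_sumT p.+1)).
have mF : measurable_fun setT F.
  by apply: emeasurable_funM; [exact: (measurableT_comp mI1 measurable_fst)
    |exact: (measurableT_comp mI2 measurable_fst)].
have F0 u : (0 <= F u)%E by rewrite mule_ge0 ?lee_fin.
have sumE (U : Type) (Y : R -> U -> R) w :
    sumT [tuple increment Y a i w | i < p.+1] = Y (a p.+1) w - Y 0 w.
  rewrite /sumT; under eq_bigr do rewrite tnth_mktuple.
  rewrite -(big_mkord xpredT (fun i => increment Y a i w)).
  by rewrite (telescope_sumr (fun i => Y (a i) w))// a0.
have -> : P' A = (\int[P']_w F ([tuple increment L a i w | i < p.+1], L T w))%E.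
  rewrite -[X in P' X](setIT A) -integral_indic//.
  apply: ge0_ae_eq_integral => //.
  - exact: measurable_EFin_indic.
  - apply: (measurableT_comp mF); apply/measurable_fun_pairP; split => //.
    by apply: (bridge_measurable procL) => //; exact: ltW.
  - have := bridge_initial_value T0 levyX Xf procL LT Lcdf.
    apply: filterS => w L0 _.
    by rewrite /F /A indicI EFinM /= initE sumE L0 subr0.
apply: (etrans (bridge_increments_law T0 levyX Xf procL LT Lcdf grid_a mF F0)).
have mass0 y : (0 <= bridge_mass (a p.+1) y)%E by exact: bridge_mass_ge0.
have mmass : measurable_fun setT (bridge_mass (a p.+1)).
  exact: measurable_bridge_mass.
pose H (v : p.+1.-tuple R) := (F (v, 0%R) * bridge_mass (a p.+1) (sumT v))%E.
have mH : measurable_fun setT H.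
  apply: emeasurable_funM; first exact: emeasurable_funM.
  exact: (measurableT_comp mmass (@measurable_sumT p.+1)).
have H0 v : (0 <= H v)%E by rewrite mule_ge0.
transitivity (\int[P]_w H [tuple increment X a i w | i < p.+1])%E.
  apply: eq_integral => w _; rewrite /H /bridge_mass -ge0_integralZl//; last 2 first.
  - by apply: (measurable_bridge_ratio T0 Xf) => //; exact: measurable_cst.
  - by move=> z _; exact: (bridge_ratio_ge0 T0 Xf).
  apply: eq_integral => z _; congr (_ * bridge_ratio _ _ _ _ _)%E.
  by apply: eq_bigr => i _; rewrite tnth_mktuple.
have d0 : 0 < a p.+1 - a p by rewrite subr_gt0 a_lt.
have dT : a p.+1 - a p <= T by rewrite lerBlDr (le_trans (ltW aN))// lerDl.
have dens := Xf d0 dT.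
have [mf f0 _] := dens.
apply: (etrans (levy_increments_resample levyX a0_ge a_nd (j := @ord_max p) dens mH H0)).
pose V w := [tuple increment X a i w | i < p].
have mV : measurable_fun setT V by exact: measurable_levy_increments.
pose G (u : R * W) := ((\1_C (V u.2))%:E * ((\1_B (sumT (V u.2) + u.1)%R)%:E *
  (bridge_mass (a p.+1) (sumT (V u.2) + u.1)%R * f (a p.+1 - a p)%R u.1)))%E.
have mVs : measurable_fun setT (fun u : R * W => sumT (V u.2) + u.1).
  apply: measurable_funD; last exact: measurable_fst.
  exact: (measurableT_comp (measurableT_comp (@measurable_sumT p) mV) measurable_snd).
have mG : measurable_fun setT G.
  apply: emeasurable_funM.
    exact: (measurableT_comp (measurableT_comp (measurable_EFin_indic mC) mV) measurable_snd).
  apply: emeasurable_funM; first exact: (measurableT_comp (measurable_EFin_indic mB) mVs).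
  apply: emeasurable_funM; first exact: (measurableT_comp mmass mVs).
  exact: (measurableT_comp mf measurable_fst).
have G0 u : (0 <= G u)%E by rewrite !mule_ge0 ?lee_fin.
transitivity (\int[lebesgue_measure]_y \int[P]_w G (y, w))%E.
  apply: eq_integral => y _; rewrite -ge0_integralZr//; last first.
  - apply: (measurableT_comp mH); apply: measurable_fun_mktuple => i.
    by case: eqP => // _; exact: (measurable_increment levyX a0_ge a_nd).
  apply: eq_integral => w _; rewrite /H /F /G /=.
  set v := [tuple (if _ then _ else _) | _ < _].
  have -> : init v = V w.
    apply: eq_from_tnth => i; rewrite !tnth_mktuple.
    rewrite (nth_mktuple _ 0 (widen_ord (leqnSn p) i)) ifN//.
    by apply/eqP => /(congr1 val)/= ip; have := ltn_ord i; rewrite ip ltnn.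
  have -> : sumT v = sumT (V w) + y.
    rewrite /sumT big_ord_recr/= tnth_mktuple eqxx; congr (_ + _).
    apply: eq_bigr => i _; rewrite !tnth_mktuple ifN//.
    by apply/eqP => /(congr1 val)/= ip; have := ltn_ord i; rewrite ip ltnn.
  by rewrite -!muleA.
apply: (etrans (fubini_tonelli (m1 := @lebesgue_measure R) (m2 := P) G mG G0)).
pose k (x : R) := (\int[lebesgue_measure]_(y in B)
  (bridge_mass (a p.+1) y * f (a p.+1 - a p) (y - x)%R))%E.
have kE x : k x = (\int[lebesgue_measure]_y ((\1_B (x + y)%R)%:E *
    (bridge_mass (a p.+1) (x + y)%R * f (a p.+1 - a p)%R y)))%E.
  rewrite /k integral_indicM; apply: (etrans (integral_shift x _ _)).
  - apply: emeasurable_funM; first exact: measurable_EFin_indic.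
    apply: emeasurable_funM => //; apply: measurableT_comp => //.
    exact: measurable_funB.
  - by move=> y; rewrite !mule_ge0 ?lee_fin.
  - by apply: eq_integral => y _; rewrite [x + y - x]addrC addKr.
have k0 x : (0 <= k x)%E.
  by apply: integral_ge0 => y _; rewrite mule_ge0.
have mk : measurable_fun setT k.
  rewrite (_ : k = fun x => \int[lebesgue_measure]_y ((\1_B (x + y)%R)%:E *
    (bridge_mass (a p.+1) (x + y)%R * f (a p.+1 - a p)%R y))%E)%E; last first.
    exact/funext.
  apply: (measurable_fun_fubini_tonelli_F (m2 := @lebesgue_measure R)
    (fun u : R * R => (\1_B (u.1 + u.2)%R)%:E *
    (bridge_mass (a p.+1) (u.1 + u.2)%R * f (a p.+1 - a p)%R u.2))%E).
    have mD : measurable_fun setT (fun u : R * R => u.1 + u.2) by exact: measurable_funD.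
    apply: emeasurable_funM; first exact: (measurableT_comp (measurable_EFin_indic mB) mD).
    apply: emeasurable_funM; first exact: (measurableT_comp mmass mD).
    exact: (measurableT_comp mf measurable_snd).
  by move=> u; rewrite !mule_ge0 ?lee_fin.
have mksum : measurable_fun setT (fun x : p.-tuple R => k (sumT x)).
  exact: (measurableT_comp mk (@measurable_sumT p)).
rewrite (ge0_integral_pushforward mV P mC (measurable_funTS mksum) (fun x _ => k0 _)).
rewrite [RHS]integral_indicM; apply: eq_integral => w _ /=.
rewrite kE -ge0_integralZl//.
- apply: emeasurable_funM.
    apply: (measurableT_comp (measurable_EFin_indic mB)).
    exact: measurable_funD.
  apply: emeasurable_funM => //; apply: (measurableT_comp mmass).
  exact: measurable_funD.
- by move=> y _; rewrite !mule_ge0 ?lee_fin.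
Qed.

End transition.

Hypothesis convolution : forall s t x : R, 0 < s -> s < t -> t <= T ->
  f t x = (\int[lebesgue_measure]_y (f (t - s)%R (x - y)%R * f s y))%E.

(** The Chapman-Kolmogorov identity of the densities, integrated over the end
    point of the bridge. *)
Lemma bridge_mass_transition s t x : 0 <= s -> s < t -> t < T ->
  (\int[lebesgue_measure]_y (bridge_mass t y * f (t - s)%R (y - x)%R) =
   bridge_mass s x)%E.
Proof.
move=> s0 st tT.
have ts0 : 0 < t - s by rewrite subr_gt0.
have tsT : t - s <= T by rewrite lerBlDr (le_trans (ltW tT))// lerDl.
have t0 : 0 <= t by rewrite (le_trans s0)// ltW.
have mf := measurable_density Xf ts0 tsT.
have f0 := density_ge0 Xf _ ts0 tsT.
have mfx : measurable_fun setT (fun y : R => f (t - s) (y - x)).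
  by apply: measurableT_comp => //; exact: measurable_funB.
pose F (u : R * R) := (bridge_ratio f T t u.1 u.2 * f (t - s) (u.1 - x))%E.
have F0 u : (0 <= F u)%E.
  by rewrite mule_ge0//; exact: (bridge_ratio_ge0 T0 Xf).
have mF : measurable_fun setT F.
  apply: emeasurable_funM.
    exact: (measurable_bridge_ratio (x := fst) (z := snd) T0 Xf).
  exact: (measurableT_comp mfx measurable_fst).
transitivity (\int[lebesgue_measure]_y \int[nu]_z F (y, z))%E.
  apply: eq_integral => y _; rewrite /F /= ge0_integralZr//.
  - by apply: (measurable_bridge_ratio T0 Xf) => //; exact: measurable_cst.
  - by move=> z _; exact: (bridge_ratio_ge0 T0 Xf).
apply: (etrans (fubini_tonelli (m1 := @lebesgue_measure R) (m2 := nu) F mF F0)).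
apply: eq_integral => z _.
rewrite /F /bridge_ratio /=.
have Tt0 : 0 < T - t by rewrite subr_gt0.
have TtT : T - t <= T by rewrite gerBl.
have mfz : measurable_fun setT (fun y : R => f (T - t) (z - y)).
  by apply: measurableT_comp; [exact: (measurable_density Xf Tt0 TtT)|exact: measurable_funB].
under eq_integral do rewrite muleAC.
rewrite ge0_integralZr//; last 3 first.
- exact: emeasurable_funM.
- by move=> y _; rewrite mule_ge0//; exact: (density_ge0 Xf).
- by rewrite inve_ge0; apply: (density_ge0 Xf).
congr (_ / _)%E.
rewrite (integral_shift x); last 2 first.
- exact: emeasurable_funM.
- by move=> y; rewrite mule_ge0//; exact: (density_ge0 Xf).
rewrite (convolution (z - x) ts0 (t := T - s)); last 2 first.
- by rewrite ltrD2r.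
- by rewrite gerBl.
apply: eq_integral => y _; congr (f _ _ * f _ _)%E.
- by rewrite opprB addrA subrK.
- by rewrite opprD addrA.
- by rewrite [x + y]addrC addrK.
Qed.

End bridge_transitions.

(** * Change of time scale *)

Section cadlag_processes.
Context {R : realType}.

Lemma cadlagD (D : set R) (x y : R -> R) :
  cadlag D x -> cadlag D y -> cadlag D (x + y).
Proof.
move=> cx cy t Dt; have [xr [lx xl]] := cx t Dt; have [yr [ly yl]] := cy t Dt.
by split; [exact: cvgD|exists (lx + ly); exact: cvgD].
Qed.

Lemma cadlag_sum (D : set R) n (x : 'I_n -> R -> R) :
  (forall i, cadlag D (x i)) -> cadlag D (fun t => \sum_(i < n) x i t).
Proof.
move=> cx; rewrite (_ : (fun _ => _) = \sum_(i < n) x i); last first.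
  by apply/funext => t; rewrite fct_sumE.
elim/big_ind: _ => [|y z|i _]; [|exact: cadlagD|exact: cx].
by move=> t _; split; [exact: cvg_cst|exists 0; exact: cvg_cst].
Qed.

Lemma within_scale (D E : set R) (S S' : set R) (c t : R) :
  (forall u, D u -> E (c * u)) -> (forall u, S u -> S' (c * u)) ->
  (c * u) @[u --> within D (within S (nbhs t))] -->
  within E (within S' (nbhs (c * t))).
Proof.
move=> DE SS A EA.
have ct : (c * u) @[u --> t] --> c * t by apply: cvgMl_tmp; exact: cvg_id.
have cA : \forall u \near t, S' (c * u) -> E (c * u) -> A (c * u) := ct _ EA.
suff : \forall u \near t, S u -> D u -> A (c * u) by [].
by apply: filterS cA => u Au /SS Su /DE Eu; exact: Au.
Qed.

Lemma cadlag_scale (D E : set R) (x : R -> R) c : 0 < c ->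
  (forall u, D u -> E (c * u)) -> cadlag E x -> cadlag D (fun t => x (c * t)).
Proof.
move=> c0 DE cx t Dt; have [xr [l xl]] := cx (c * t) (DE _ Dt).
split; [|exists l].
- apply: cvg_comp xr; apply: within_scale => // u /=.
  by rewrite ltr_pM2l.
- apply: cvg_comp xl; apply: within_scale => // u /=.
  by rewrite ltr_pM2l.
Qed.

Lemma levy_process_scale d (W : measurableType d) (P : probability W R)
    (X : R -> W -> R) c : 0 < c ->
  levy_process P X -> levy_process P (fun t => X (c * t)).
Proof.
move=> c0 [[mX cX] X0 stat indep].
have cge0 : 0 <= c by exact: ltW.
split.
- split=> [t|w]; first by rewrite /= !in_itv/= !andbT => t0; apply: mX; rewrite /= in_itv/= mulr_ge0.
  apply: (cadlag_scale c0 _ (cX w)) => u /=.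
  by rewrite !in_itv/= !andbT => u0; rewrite mulr_ge0.
- by apply: filterS X0 => w; rewrite mulr0.
- move=> u t u0 ut B mB; rewrite mulrBr.
  by apply: stat => //; rewrite ?mulr_ge0// ler_pM2l.
- move=> k t B t0 t_nd mB.
  apply: (indep k (fun i => c * t i)) => //; first by rewrite mulr_ge0.
  by move=> i j ij; rewrite ler_pM2l// t_nd.
Qed.

Lemma bridge_integral_scale (f : R -> R -> \bar R) c z t0 y0
    (txs : seq (R * R)) :
  bridge_integral (fun t => f (c * t)) 1 z t0 y0 txs =
  bridge_integral f c z (c * t0) y0 [seq (c * tx.1, tx.2) | tx <- txs].
Proof.
elim: txs t0 y0 => [|[t x] txs IH] t0 y0 /=; first by rewrite mulrBr mulr1.
by apply: eq_integral => y _; rewrite IH mulrBr.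
Qed.

Lemma levy_bridge_cdf_scale (f : R -> R -> \bar R) c k (t x : k.-tuple R) :
  levy_bridge_cdf (fun t => f (c * t)) 1 t x =
  levy_bridge_cdf f c [tuple of map ( *%R c) t] x.
Proof.
apply/funext => z; rewrite /levy_bridge_cdf bridge_integral_scale mulr0.
congr bridge_integral; apply: (@eq_from_nth _ (0, 0)) => [|i].
  by rewrite size_map !size_zip !size_tuple.
rewrite size_map size_zip (size_tuple t) (size_tuple x) minnn => ik.
rewrite (nth_map (0, 0)) ?size_zip ?(size_tuple t) ?(size_tuple x) ?minnn//.
rewrite !nth_zip ?size_tuple//= (nth_map 0) ?size_tuple//.
Qed.

End cadlag_processes.

(** * The total of a Liouville process *)

Section liouville_total.
Context {R : realType} (p : nat).
Local Notation n := p.+1.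
Context (m : n.-tuple R).
Hypotheses (n2 : (2 <= n)%N) (m0 : forall i, 0 < tnth m i).
Local Notation c := (usum m n).

Context (f : R -> R -> \bar R) (nu : probability R R).
Context dX (WX : measurableType dX) (PX : probability WX R) (X : R -> WX -> R).
Hypotheses (levyX : levy_process PX X)
  (Xf : forall t, 0 < t -> t <= c -> has_density PX (X t) (f t)).
Hypothesis convolution : forall s t x : R, 0 < s -> s < t -> t <= c ->
  f t x = (\int[lebesgue_measure]_y (f (t - s)%R (x - y)%R * f s y))%E.
Hypothesis fT : {ae nu, forall z, (0 < f c z < +oo)%E}.
Context dL (WL : measurableType dL) (PL : probability WL R) (L : R -> WL -> R).
Hypotheses (procL : real_process `[0, c] L)
  (LT : forall B, measurable B -> PL (L c @^-1` B) = nu B)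
  (Lcdf : forall (k : nat) (t x : k.+1.-tuple R), path <%R 0 (rcons t c) ->
     cond_prob_version PL [set w | forall i, L (tnth t i) w <= tnth x i]
       (L c) (levy_bridge_cdf f c t x)).
Context d (W : measurableType d) (P : probability W R) (xi : R -> W -> n.-tuple R).
Hypotheses (procxi : vector_process `[0, 1] xi)
  (xiL : equal_in_law `[0, 1] P xi PL (GLP_of_LRB m L)).

Local Notation glp := (GLP_of_LRB m L).
Local Notation total := (fun (t : R) (w : W) => ones_dot (xi t w)).

Let c0 : 0 < c. Proof. exact: usum_gt0. Qed.

Lemma usum_nd : {homo usum m : i j / (i <= j)%N >-> i <= j}.
Proof.
apply: (homo_leq (r := <=%R)) => // [x y z|i]; first exact: le_trans.
by rewrite usumS lerDl activity_ge0.
Qed.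

Lemma measurable_ones_dot : measurable_fun setT (@ones_dot R n).
Proof. by apply: measurable_sum => i; exact: measurable_tnth. Qed.

Lemma measurable_xi t : 0 <= t -> t <= 1 -> measurable_fun setT (xi t).
Proof.
move=> t0 t1; apply/measurable_fun_tnthP => i.
by have [mxi _] := procxi i; apply: mxi; rewrite /= in_itv/= t0.
Qed.

Lemma measurable_total t : 0 <= t -> t <= 1 -> measurable_fun setT (total t).
Proof.
by move=> t0 t1; exact: (measurableT_comp measurable_ones_dot (measurable_xi t0 t1)).
Qed.

Lemma measurable_glp t : 0 <= t -> t <= 1 -> measurable_fun setT (glp t).
Proof.
move=> t0 t1; apply: measurable_fun_mktuple => i.
have mi := activity_ge0 m0 i; have ui : 0 <= usum m i by rewrite -(usum0 m) usum_nd.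
apply: measurable_funB; apply: (bridge_measurable procL) => //.
- by rewrite addr_ge0// mulr_ge0// (tnth_nth 0).
- apply: (@le_trans _ _ (usum m i.+1)); last by rewrite usum_nd.
  by rewrite usumS addrC lerD2l (tnth_nth 0) ler_piMl.
- by rewrite usum_nd// ltnW.
Qed.

Lemma glp_initial w : glp 0 w = [tuple 0 | _ < n].
Proof. by apply: eq_from_tnth => i; rewrite !tnth_mktuple mul0r add0r subrr. Qed.

Lemma glp_total_final w : ones_dot (glp 1 w) = L c w - L 0 w.
Proof.
rewrite /ones_dot; under eq_bigr => i _ do
  rewrite tnth_mktuple mul1r [tnth m i + _]addrC (tnth_nth 0) -usumS.
rewrite -(big_mkord xpredT (fun i => L (usum m i.+1) w - L (usum m i) w)).
by rewrite (telescope_sumr (fun i => L (usum m i) w))// usum0.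
Qed.

Lemma grid_of_path k (t : k.+1.-tuple R) : path <%R 0 (rcons t 1) ->
  is_grid 1 k.+1 (nth 1 (0 :: t)).
Proof.
move=> /(pathP 1) t_lt.
have tE i : nth 1 (0 :: rcons t 1) i = nth 1 (0 :: t) i.
  case: i => //= i; rewrite nth_rcons; case: ltngtP => //= [|->].
    by move=> it; rewrite nth_default// ltnW.
  by rewrite nth_default.
have tS i : nth 1 (rcons t 1) i = nth 1 (0 :: t) i.+1.
  by rewrite -tE.
have lt i : (i <= k.+1)%N -> nth 1 (0 :: t) i < nth 1 (0 :: t) i.+1.
  move=> ik; rewrite -tE -tS; apply: t_lt.
  by rewrite size_rcons size_tuple.
split => //; last by rewrite /= nth_default// size_tuple.
apply: (homo_leq (r := <=%R)) => // [x y z|i]; first exact: le_trans.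
have [ik|ki] := leqP i k.+1; first exact/ltW/lt.
by rewrite !nth_default//= size_tuple// ltnW.
Qed.

Section joint_laws.
Variables (k : nat) (s : nat -> R).
Hypothesis grid_s : is_grid 1 k.+1 s.

Let sle i : (i <= k.+2)%N -> 0 <= s i <= 1.
Proof. by have [<- s_nd _ <-] := grid_s; move=> iK; rewrite !s_nd. Qed.
Let s1 : s k.+2 = 1. Proof. by case: grid_s. Qed.

(** Equality in law only concerns finitely many times, and this is enough: the
    total at time 1 is the end point of the bridge because the bridge starts at
    0, and the reordering of intervals settles the earlier times. *)
Lemma liouville_joint_law (A : set (n.-tuple R * k.+1.-tuple R * R)) :
  measurable A ->
  P ((fun w => (xi (s 1%N) w, [tuple total (s j.+1) w | j < k.+1], total 1 w))
       @^-1` A) =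
  PL ((fun w => ([tuple increment L (time_grid m s) i w | i < n],
       [tuple L (c * s j.+1)%R w | j < k.+1], L c w)) @^-1` A).
Proof.
move=> mA; pose tau : k.+2.-tuple R := [tuple s j.+1 | j < k.+2].
pose obs (v : k.+2.-tuple (n.-tuple R)) : n.-tuple R * k.+1.-tuple R * R :=
  (tnth v ord0, [tuple ones_dot (tnth v (widen_ord (leqnSn k.+1) j)) | j < k.+1],
   ones_dot (tnth v ord_max)).
have mobs : measurable_fun setT obs.
  apply/measurable_fun_pairP; split; last first.
    exact: (measurableT_comp measurable_ones_dot (@measurable_tnth _ _ _ ord_max)).
  apply/measurable_fun_pairP; split; first exact: measurable_tnth.
  apply: measurable_fun_mktuple => j.
  exact: (measurableT_comp measurable_ones_dot (@measurable_tnth _ _ _ _)).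
have obsE d1 (U : measurableType d1) (Y : R -> U -> n.-tuple R) w : obs (fdd Y tau w) =
    (Y (s 1%N) w, [tuple ones_dot (Y (s j.+1) w) | j < k.+1], ones_dot (Y 1 w)).
  rewrite /obs; congr (_, _, _).
  - by rewrite /fdd !tnth_mktuple.
  - by apply: eq_from_tnth => j; rewrite !tnth_mktuple.
  - by rewrite /fdd !tnth_mktuple /= s1.
have -> : (fun w => (xi (s 1%N) w, [tuple total (s j.+1) w | j < k.+1], total 1 w)) =
    obs \o fdd xi tau by apply/funext => w; rewrite /= obsE.
rewrite comp_preimage xiL; last 2 first.
- move=> i; rewrite tnth_mktuple /= in_itv/=; apply: sle.
  exact: ltn_ord.
- by rewrite -[X in measurable X]setTI; exact: mobs.
have mglp : measurable_fun setT (fun w => (glp (s 1%N) w,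
    [tuple ones_dot (glp (s j.+1) w) | j < k.+1])).
  apply/measurable_fun_pairP; split.
    by have /andP[] := sle (isT : (1 <= k.+2)%N); exact: measurable_glp.
  apply: measurable_fun_mktuple => j; apply: (measurableT_comp measurable_ones_dot).
  have /andP[] : 0 <= s j.+1 <= 1 by apply: sle; rewrite ltnW// ltnS.
  exact: measurable_glp.
have mLc : measurable_fun setT (L c).
  by apply: (bridge_measurable procL) => //; exact: ltW.
have mglp1 : measurable_fun setT (fun w => ones_dot (glp 1 w)).
  exact: (measurableT_comp measurable_ones_dot (measurable_glp ler01 (lexx 1))).
pose G q : \bar R := (\1_A q)%:E.
have mG : measurable_fun setT G by exact: measurable_EFin_indic.
have G0 q : (0 <= G q)%E by rewrite lee_fin.
have probE d1 (U : measurableType d1) (Q : probability U R) (Y : U -> _) :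
    measurable_fun setT Y -> Q (Y @^-1` A) = (\int[Q]_w G (Y w))%E.
  move=> mY; have mYA : measurable (Y @^-1` A).
    by rewrite -[X in measurable X]setTI; exact: mY.
  by rewrite -[X in Q X]setIT -integral_indic.
have mfin : measurable_fun setT (fun w => ([tuple increment L (time_grid m s) i w | i < n],
       [tuple L (c * s j.+1)%R w | j < k.+1], L c w)).
  have [b0 b_nd _ bT] := time_grid_is_grid n2 m0 grid_s.
  apply/measurable_fun_pairP; split => //; apply/measurable_fun_pairP; split.
    have mLb i : (i <= n)%N -> measurable_fun setT (L (time_grid m s i)).
      move=> iN; apply: (bridge_measurable procL); first by rewrite -b0 b_nd.
      rewrite -bT b_nd// (leq_trans iN)// grid_size// ?leq_pmulr//.
    apply: measurable_fun_mktuple => i.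
    by apply: measurable_funB; apply: mLb; rewrite // ltnW.
  apply: measurable_fun_mktuple => j.
  have /andP[sj0 sj1] : 0 <= s j.+1 <= 1 by apply: sle; rewrite ltnW// ltnS.
  apply: (bridge_measurable procL); first by rewrite mulr_ge0// ltW.
  by rewrite ger_pMr.
rewrite (probE _ _ PL _ mfin).
rewrite -(glp_law n2 m0 levyX Xf procL LT Lcdf grid_s mG G0).
rewrite -comp_preimage probE; last first.
  rewrite (_ : _ \o _ = fun w => (glp (s 1%N) w,
     [tuple ones_dot (glp (s j.+1) w) | j < k.+1], ones_dot (glp 1 w))).
    by apply/measurable_fun_pairP; split.
  by apply/funext => w; rewrite /= obsE.
apply: ge0_ae_eq_integral => //.
- apply: (measurableT_comp mG).
  rewrite (_ : _ \o _ = fun w => (glp (s 1%N) w,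
     [tuple ones_dot (glp (s j.+1) w) | j < k.+1], ones_dot (glp 1 w))).
    by apply/measurable_fun_pairP; split.
  by apply/funext => w; rewrite /= obsE.
- by apply: (measurableT_comp mG); apply/measurable_fun_pairP; split.
have := bridge_initial_value c0 levyX Xf procL LT Lcdf.
by apply: filterS => w L0 _; rewrite /= obsE glp_total_final L0 subr0.
Qed.

End joint_laws.


Let half_path : path <%R 0 (rcons [tuple (2^-1 : R)] 1).
Proof. by rewrite /= invr_gt0 ltr0n invf_lt1// ltr1n. Qed.

Lemma total_final_law B : measurable B -> P (total 1 @^-1` B) = nu B.
Proof.
move=> mB; rewrite -LT//.
have mA : measurable ([set q | B q.2] : set (n.-tuple R * 1.-tuple R * R)).
  by rewrite -[X in measurable X]setTI; exact: measurable_snd.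
exact: (liouville_joint_law (grid_of_path half_path) mA).
Qed.

(** At the times of a subdivision the total has the law of the bridge run at
    speed [c], and the bridge law is compatible with changes of time scale. *)
Lemma total_is_LRB : LRB 1 nu P total.
Proof.
exists (fun t => f (c * t)); split; first exact: ltr01.
have cge0 : 0 <= c by exact: ltW.
split.
  exists dX, WX, PX, (fun t => X (c * t)); split; first exact: levy_process_scale.
  by move=> t t0 t1; apply: Xf; rewrite ?mulr_gt0// ger_pMr.
split.
  move=> s t x s0 st t1; rewrite (@convolution (c * s)) ?mulr_gt0 ?ltr_pM2l ?ger_pMr//.
  by apply: eq_integral => y _; rewrite mulrBr.
split; first by rewrite mulr1.
split.
  split=> [t|w]; first by rewrite /= in_itv/= => /andP[]; exact: measurable_total.
  by apply: cadlag_sum => i; have [_ cxi] := procxi i; exact: cxi.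
split; first exact: total_final_law.
move=> k t x pt.
have pct : path <%R 0 (rcons [tuple of map ( *%R c) t] c).
  rewrite [rcons _ _](_ : _ = map ( *%R c) (rcons t 1)); last first.
    by rewrite map_rcons mulr1.
  rewrite -[X in path _ X](mulr0 c) path_map.
  by rewrite (eq_path (e' := <%R)) => // u v; rewrite /= ltr_pM2l.
have [mcdf cdfE] := Lcdf x pct.
rewrite levy_bridge_cdf_scale; split; first exact: mcdf.
move=> C mC.
pose A : set (n.-tuple R * k.+1.-tuple R * R) := [set q | orthant x q.1.2 /\ C q.2].
have mA : measurable A.
  apply: measurableI; rewrite -[X in measurable X]setTI.
    have := measurableT_comp (@measurable_snd _ _ (n.-tuple R) (k.+1.-tuple R))
      (@measurable_fst _ _ _ R).
    by apply => //; exact: measurable_orthant.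
  exact: measurable_snd.
have tE (i : 'I_k.+1) : nth 1 t i = tnth t i by rewrite (tnth_nth 1).
transitivity (PL ([set w | forall i, L (tnth [tuple of map ( *%R c) t] i) w <= tnth x i]
    `&` L c @^-1` C)).
  have := liouville_joint_law (grid_of_path pt) mA.
  congr (_ = _); [congr (P _)|congr (PL _)]; apply/seteqP; split => w /= [H Cw];
    by split => // i; have := H i; rewrite ?tnth_mktuple /= ?tE ?tnth_map.
rewrite cdfE//.
have mLc : measurable_fun setT (L c).
  by apply: (bridge_measurable procL) => //; exact: ltW.
apply: (eq_measure_integral
  (image_measure P
     (measurable_total ler01 (lexx 1)))) => B mB _.
by rewrite /= /pushforward LT// total_final_law.
Qed.


Lemma thetaE t B x : t != 0 ->
  theta f c nu t B x = (\int[nu]_(z in B) bridge_ratio f c (c * t) x z)%E.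
Proof.
by move=> /negbTE t0; rewrite /theta t0 /bridge_ratio mulrBr mulr1.
Qed.

Lemma ThetaE t x : t != 0 -> Theta f c nu t x = bridge_mass f c nu (c * t) x.
Proof. by move=> t0; rewrite /Theta thetaE. Qed.

Lemma Theta0 x : Theta f c nu 0 x = 1%E.
Proof. by rewrite /Theta /theta eqxx probability_setT. Qed.

Let scaled_time t : 0 <= t -> t < 1 -> 0 <= c * t /\ c * t < c.
Proof. by move=> t0 t1; rewrite mulr_ge0 ?(ltW c0)// gtr_pMr. Qed.

Lemma theta_ge0 t B x : 0 <= t -> t < 1 -> (0 <= theta f c nu t B x)%E.
Proof.
move=> t0 t1; have [->|tn0] := eqVneq t 0; first by rewrite /theta eqxx.
have [ct0 ct1] := scaled_time t0 t1.
by rewrite thetaE//; apply: integral_ge0 => z _; exact: (bridge_ratio_ge0 c0 Xf).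
Qed.

Lemma measurable_theta t B : 0 <= t -> t < 1 -> measurable B ->
  measurable_fun setT (theta f c nu t B).
Proof.
move=> t0 t1 mB; have [->|tn0] := eqVneq t 0.
  rewrite (_ : theta _ _ _ _ _ = cst (nu B)); first exact: measurable_cst.
  by apply/funext => x; rewrite /theta eqxx.
have [ct0 ct1] := scaled_time t0 t1.
rewrite (_ : theta _ _ _ _ _ = fun x =>
    (\int[nu]_(z in B) bridge_ratio f c (c * t) x z)%E); last first.
  by apply/funext => x; exact: thetaE.
exact: (measurable_bridge_kernel nu c0 Xf ct0 ct1 (@measurable_id _ _ _) mB).
Qed.

Lemma theta_measure t x : 0 <= t -> t < 1 ->
  exists K : {measure set R -> \bar R},
    forall B, measurable B -> K B = theta f c nu t B x.
Proof.
move=> t0 t1; have [->|tn0] := eqVneq t 0.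
  by exists nu => B _; rewrite /theta eqxx.
have [ct0 ct1] := scaled_time t0 t1.
have mr : measurable_fun setT (bridge_ratio f c (c * t) x).
  by apply: (measurable_bridge_ratio c0 Xf) => //; exact: measurable_cst.
have r0 z : (0 <= bridge_ratio f c (c * t) x z)%E by exact: (bridge_ratio_ge0 c0 Xf).
by exists (density_measure nu mr r0) => B mB; rewrite thetaE.
Qed.

(** The subdivision that is left when only the first time step of [time_grid] and
    the later times [ends] are observed. *)
Definition block_grid (s : R) (ends : seq R) (q : nat) : R :=
  if (q <= n)%N then s * usum m q else nth c ends (q - n.+1).

Lemma block_grid_is_grid s ends : 0 < s -> path <%R (s * c) (rcons ends c) ->
  is_grid c (n + size ends) (block_grid s ends).
Proof.
move=> s0 /(pathP c) ends_lt.
have nE i : nth c (s * c :: rcons ends c) i = nth c (s * c :: ends) i.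
  case: i => //= i; rewrite nth_rcons; case: ltngtP => //= [|->].
    by move=> it; rewrite nth_default// ltnW.
  by rewrite nth_default.
have blockE j : block_grid s ends (n + j) = nth c (s * c :: ends) j.
  rewrite /block_grid; case: j => [|j]; first by rewrite addn0 leqnn.
  by rewrite ifN -?ltnNge ?addnS ?ltnS ?leq_addr// subSS addKn.
have lt q : (q <= n + size ends)%N -> block_grid s ends q < block_grid s ends q.+1.
  have [qn _|nq] := ltnP q n.
    by rewrite /block_grid qn ltnW// ltr_pM2l// usumS ltrDl activity_gt0.
  rewrite -(subnKC nq) leq_add2l -addnS !blockE => jN; rewrite -!nE.
  by apply: ends_lt; rewrite size_rcons.
split => //.
- by rewrite /block_grid /= usum0 mulr0.
- apply: (homo_leq (r := <=%R)) => // [x y z|q]; first exact: le_trans.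
  have [qN|Nq] := leqP q (n + size ends); first exact/ltW/lt.
  have nq : (n <= q)%N by rewrite (leq_trans (leq_addr _ _) (ltnW Nq)).
  move: Nq; rewrite -(subnKC nq) ltn_add2l -addnS !blockE => jN.
  by rewrite !nth_default//= ltnW.
- by rewrite -addnS blockE /= nth_default.
Qed.

Lemma first_block s (s' : nat -> R) ends (i : nat) : s' 0%N = 0 -> s' 1%N = s ->
  (i < n)%N ->
  increment L (time_grid m s') i = increment L (block_grid s ends) i.
Proof.
move=> s'0 s'1 ni; have tg j : (j <= n)%N -> time_grid m s' j = s * usum m j.
  move=> jn; have := time_gridE m n2 s' 0 jn.
  by rewrite mul0n add0n s'0 s'1 mulr0 add0r subr0.
by rewrite /increment /block_grid !tg// ?ni ltnW.
Qed.


Local Notation zero_tuple := ([tuple 0 | _ < n] : n.-tuple R).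

Lemma initial_joint_law t C B : 0 <= t -> t <= 1 -> measurable C -> measurable B ->
  P (xi 0 @^-1` C `&` total t @^-1` B) =
  (\d_zero_tuple C * P (total t @^-1` B))%E.
Proof.
move=> t0 t1 mC mB; pose tau : 2.-tuple R := [tuple 0; t].
have tauI i : `[0, 1]%classic (tnth tau i).
  rewrite (tnth_nth 0); case: i => -[|[|]]//= _; rewrite in_itv/= ?lexx ?ler01//.
  by rewrite t0.
pose A2 : set (2.-tuple (n.-tuple R)) := [set v | B (ones_dot (tnth v ord_max))].
pose A1 : set (2.-tuple (n.-tuple R)) := [set v | C (tnth v ord0)].
have mA1 : measurable A1.
  by rewrite -[X in measurable X]setTI; exact: measurable_tnth.
have mA2 : measurable A2.
  rewrite -[X in measurable X]setTI.
  exact: (measurableT_comp measurable_ones_dot (@measurable_tnth _ _ _ ord_max)).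
have fddE d1 (U : measurableType d1) (Y : R -> U -> n.-tuple R) w :
    (tnth (fdd Y tau w) ord0 = Y 0 w) * (tnth (fdd Y tau w) ord_max = Y t w).
  by rewrite /fdd !tnth_mktuple !(tnth_nth 0).
have -> : total t @^-1` B = fdd xi tau @^-1` A2.
  by apply/seteqP; split => w; rewrite /A2/= fddE.
have -> : xi 0 @^-1` C `&` fdd xi tau @^-1` A2 = fdd xi tau @^-1` (A1 `&` A2).
  by apply/seteqP; split => w; rewrite /A1/= fddE.
rewrite !xiL//; last exact: measurableI.
rewrite diracE; have [zC|zC] := boolP (zero_tuple \in C); rewrite /= ?mul1e ?mul0e.
  congr (PL _); apply/seteqP; split => w /=; first by case.
  by move=> ?; split => //; rewrite /A1/= fddE glp_initial; rewrite inE in zC.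
rewrite -[RHS](measure0 PL); congr (PL _); apply/seteqP; split => // w /= [].
by rewrite /A1/= fddE glp_initial => Cz; move: zC; rewrite mem_set.
Qed.

Let path1 (s : R) : 0 < s -> s < 1 -> path <%R 0 (rcons [tuple s] 1).
Proof. by move=> s0 s1; rewrite /= s0 s1. Qed.

Let path2 (s t : R) : 0 < s -> s < t -> t < 1 -> path <%R 0 (rcons [tuple s; t] 1).
Proof. by move=> s0 st t1; rewrite /= s0 st t1. Qed.

Let first_block_tuple (s : R) (s' : nat -> R) ends : s' 0%N = 0 -> s' 1%N = s ->
  (fun w => [tuple increment L (time_grid m s') i w | i < n]) =
  (fun w => [tuple increment L (block_grid s ends) i w | i < n]).
Proof.
move=> s'0 s'1; apply/funext => w; apply: eq_from_tnth => i.
by rewrite !tnth_mktuple (first_block ends s'0 s'1).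
Qed.

Lemma ones_dot_zero : ones_dot zero_tuple = 0 :> R.
Proof. by rewrite /ones_dot big1// => i _; rewrite tnth_mktuple. Qed.

Lemma measurable_zero_tuple : measurable [set zero_tuple].
Proof.
rewrite (_ : [set _] = \bigcap_(i in [set: 'I_n]) ((fun v => tnth v i) @^-1` [set 0])).
  apply: fin_bigcap_measurable; first exact: finite_finset.
  move=> i _; rewrite -[X in measurable X]setTI; apply: measurable_tnth => //.
apply/seteqP; split => v /=; first by move=> -> i _; rewrite /= tnth_mktuple.
by move=> v0; apply: eq_from_tnth => i; rewrite tnth_mktuple; exact: v0.
Qed.

Section transition_density.
Variables s t : R.
Hypotheses (s_ge0 : 0 <= s) (lt_st : s < t) (t_lt1 : t < 1).

Let t_ge0 : 0 <= t. Proof. by rewrite (le_trans s_ge0)// ltW. Qed.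
Let ts0 : 0 < (t - s) * c. Proof. by rewrite mulr_gt0// subr_gt0. Qed.
Let tsc : (t - s) * c <= c.
Proof. by rewrite ger_pMl// lerBlDr (le_trans (ltW t_lt1))// lerDl. Qed.
Let mf := measurable_density Xf ts0 tsc.
Let f0 x := density_ge0 Xf x ts0 tsc.

Lemma transition_density_ge0 (g : n.-tuple R -> \bar R) x y : (forall x, 0 <= g x)%E ->
  (0 <= Theta f c nu t y * g x * f ((t - s) * c) (y - ones_dot x))%E.
Proof. by move=> g0; rewrite !mule_ge0// theta_ge0. Qed.

Lemma measurable_transition_density (g : n.-tuple R -> \bar R) :
  measurable_fun setT g ->
  measurable_fun setT (fun u : n.-tuple R * R =>
    Theta f c nu t u.2 * g u.1 * f ((t - s) * c) (u.2 - ones_dot u.1))%E.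
Proof.
move=> mg; apply: emeasurable_funM.
  apply: emeasurable_funM; last exact: (measurableT_comp mg measurable_fst).
  exact: (measurableT_comp (measurable_theta t_ge0 t_lt1 measurableT) measurable_snd).
apply: (measurableT_comp mf); apply: measurable_funB => //.
exact: (measurableT_comp measurable_ones_dot measurable_fst).
Qed.

Lemma measurable_transition (g : n.-tuple R -> \bar R) B :
  measurable_fun setT g -> (forall x, 0 <= g x)%E -> measurable B ->
  measurable_fun setT (fun x : n.-tuple R => \int[lebesgue_measure]_(y in B)
    (Theta f c nu t y * g x * f ((t - s) * c) (y - ones_dot x)%R))%E.
Proof.
move=> mg g0 mB; under eq_fun do rewrite integral_indicM.
apply: (measurable_fun_fubini_tonelli_F (m2 := @lebesgue_measure R)
  (fun u : n.-tuple R * R => (\1_B u.2)%:E *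
    (Theta f c nu t u.2 * g u.1 * f ((t - s) * c)%R (u.2 - ones_dot u.1)%R))%E).
  apply: emeasurable_funM; last exact: measurable_transition_density.
  exact: (measurableT_comp (measurable_EFin_indic mB) measurable_snd).
by move=> u; apply: mule_ge0; rewrite ?lee_fin//; exact: transition_density_ge0.
Qed.

End transition_density.

(** After time 0 the reference measure is the law of the corresponding block of
    Levy increments; at time 0 the process sits at the origin, and the reference
    measure is a Dirac mass. *)
Lemma final_disintegration s : 0 <= s -> s < 1 ->
  exists mu : {measure set (n.-tuple R) -> \bar R},
    forall C B, measurable C -> measurable B ->
    P (xi s @^-1` C `&` total 1 @^-1` B) =
    (\int[mu]_(x in C) theta f c nu s B (ones_dot x))%E.
Proof.
rewrite le_eqVlt => /predU1P[<- _|s0 s1].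
  exists (\d_zero_tuple) => C B mC mB.
  rewrite initial_joint_law// total_final_law// (eq_integral (cst (nu B))).
    by rewrite integral_dirac.
  by move=> x _; rewrite /theta eqxx.
have grid_a : is_grid c n (block_grid s [::]).
  have := @block_grid_is_grid s [::] s0; rewrite addn0; apply.
  by rewrite /= gtr_pMl// s1.
have a_end : block_grid s [::] n = c * s by rewrite /block_grid leqnn mulrC.
have [a0 a_nd _ _] := grid_a.
have a0_ge : 0 <= block_grid s [::] 0 by rewrite a0.
have mV : measurable_fun setT (fun w => [tuple increment X (block_grid s [::]) i w | i < n]).
  by apply: measurable_fun_mktuple => i; exact: (measurable_increment levyX a0_ge a_nd).
exists (image_measure PX mV) => C B mC mB.
have mA : measurable ([set q | C q.1.1 /\ B q.2] : set (n.-tuple R * 1.-tuple R * R)).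
  apply: measurableI; rewrite -[X in measurable X]setTI; last exact: measurable_snd.
  exact: (measurableT_comp (@measurable_fst _ _ (n.-tuple R) (1.-tuple R))
    (@measurable_fst _ _ _ R)).
apply: (etrans (liouville_joint_law (grid_of_path (path1 s0 s1)) mA)).
have := bridge_block_law c0 levyX Xf procL LT Lcdf grid_a mC mB.
rewrite -(@first_block_tuple s (nth 1 [:: 0; s]))// => jointE.
apply: (etrans jointE); apply: eq_integral => x _.
by rewrite thetaE ?gt_eqF// a_end.
Qed.

(** The mass identity may fail at some starting points when [s = 0], where
    [Theta] is 1 by definition; at the origin it holds because the ratio of the
    density of the end point to itself is almost surely 1. *)
Lemma transition_disintegration s t : 0 <= s -> s < t -> t < 1 ->
  exists mu : {measure set (n.-tuple R) -> \bar R},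
    {ae mu, forall x, (\int[lebesgue_measure]_y (Theta f c nu t y *
       f ((t - s) * c)%R (y - ones_dot x)%R) = Theta f c nu s (ones_dot x))%E} /\
    forall C B, measurable C -> measurable B ->
    P (xi s @^-1` C `&` total t @^-1` B) =
    (\int[mu]_(x in C) \int[lebesgue_measure]_(y in B)
       (Theta f c nu t y * f ((t - s) * c)%R (y - ones_dot x)%R))%E.
Proof.
move=> s0 st t1.
have t0 : 0 < t by rewrite (le_lt_trans s0).
have s1 : s < 1 by rewrite (lt_trans st).
have [ct0 ct1] := scaled_time (ltW t0) t1.
have [cs0 cs1] := scaled_time s0 s1.
have csct : c * s < c * t by rewrite ltr_pM2l.
have tsE : (t - s) * c = c * t - c * s by rewrite mulrC mulrBr.
have mass x : (\int[lebesgue_measure]_y (Theta f c nu t y *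
    f ((t - s) * c)%R (y - x)%R) = bridge_mass f c nu (c * s) x)%E.
  rewrite -(bridge_mass_transition nu c0 Xf convolution x cs0 csct ct1).
  by apply: eq_integral => y _; rewrite ThetaE ?gt_eqF// tsE.
move: s0; rewrite le_eqVlt => /predU1P[s0|s0].
  subst s; exists (\d_zero_tuple); split.
    exists (~` [set zero_tuple]); split.
    - by apply: measurableC; exact: measurable_zero_tuple.
    - by rewrite /= /dirac indicE memNset//=; apply.
    - move=> x; apply: contra_not => ->.
      apply: (etrans (mass _)); rewrite Theta0 ones_dot_zero /bridge_mass mulr0.
      rewrite -(probability_setT nu) -[RHS]mul1e -integral_cst//.
      apply: ge0_ae_eq_integral => //.
      + by apply: (measurable_bridge_ratio c0 Xf) => //; exact: measurable_cst.
      + by move=> z _; exact: (bridge_ratio_ge0 c0 Xf).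
      + apply: filterS fT => z /andP[fz0 fzy] _.
        by rewrite /bridge_ratio !subr0 divee// ?gt_eqF// ge0_fin_numE// ltW.
  move=> C B mC mB; rewrite (initial_joint_law (ltW t0) (ltW t1) mC mB).
  have mk : measurable_fun setT (fun x : n.-tuple R => \int[lebesgue_measure]_(y in B)
      (Theta f c nu t y * f ((t - 0) * c) (y - ones_dot x)%R))%E.
    have := measurable_transition (lexx 0) st t1 (measurable_cst 1%E) (fun=> lee01) mB.
    by under eq_fun do under eq_integral do rewrite mule1.
  rewrite integral_dirac//; last exact: measurable_funTS.
  congr (_ * _)%E; rewrite ones_dot_zero.
  have mA : measurable ([set q | B (tnth q.1.2 ord0)] :
      set (n.-tuple R * 1.-tuple R * R)).
    rewrite -[X in measurable X]setTI.
    exact: (measurableT_comp (measurableT_comp (@measurable_tnth _ _ _ ord0)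
      (@measurable_snd _ _ (n.-tuple R) (1.-tuple R))) (@measurable_fst _ _ _ R)).
  have := liouville_joint_law (grid_of_path (path1 t0 t1)) mA.
  rewrite (_ : _ @^-1` _ = total t @^-1` B); last first.
    by apply/seteqP; split => w /=; rewrite tnth_mktuple.
  rewrite [X in _ = PL X](_ : _ = L (c * t) @^-1` B); last first.
    by apply/seteqP; split => w /=; rewrite tnth_mktuple.
  move=> ->; pose a q : R := match q with 0%N => 0 | 1%N => c * t | _ => c end.
  have grid_a : is_grid c 1 a.
    split => //; last by case => [|[|]]//=; rewrite mulr_gt0.
    apply: (homo_leq (r := <=%R)) => // [x y z|[|[|q]]]/=; first exact: le_trans.
    - exact: ct0.
    - exact: ltW.
    - exact: lexx.
  have := bridge_transition c0 levyX Xf procL LT Lcdf grid_a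
    (@measurableT _ (0.-tuple R)) mB.
  rewrite preimage_setT setTI /= => ->.
  have mV : measurable_fun setT (fun w => [tuple increment X a i w | i < 0]).
    by apply: measurable_fun_mktuple => -[].
  pose K := (\int[lebesgue_measure]_(y in B)
    (Theta f c nu t y * f ((t - 0) * c) (y - 0)%R))%E.
  transitivity (\int[pushforward PX (fun w => [tuple increment X a i w | i < 0])]_(x in setT)
      (cst K) x)%E.
    apply: eq_integral => [|x _]; first exact: mV.
    rewrite /= /K; apply: eq_integral => y _; rewrite big_ord0 ThetaE ?gt_eqF//.
    by rewrite !subr0 mulrC.
  apply: (etrans (integral_cst
    (image_measure PX mV) measurableT K)).
  by rewrite /= /pushforward preimage_setT probability_setT mule1.
have grid_a : is_grid c n.+1 (block_grid s [:: c * t]).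
  have := @block_grid_is_grid s [:: c * t] s0; rewrite addn1; apply.
  by rewrite /= ct1 mulrC csct.
have a_end : block_grid s [:: c * t] n.+1 = c * t.
  by rewrite /block_grid ltnn subnn.
have a_n : block_grid s [:: c * t] n = c * s by rewrite /block_grid leqnn mulrC.
have [a0 a_nd _ _] := grid_a.
have a0_ge : 0 <= block_grid s [:: c * t] 0 by rewrite a0.
have mV : measurable_fun setT
    (fun w => [tuple increment X (block_grid s [:: c * t]) i w | i < n]).
  by apply: measurable_fun_mktuple => i; exact: (measurable_increment levyX a0_ge a_nd).
exists (image_measure PX mV); split.
  by apply: aeW => x; rewrite mass ThetaE// gt_eqF.
move=> C B mC mB.
have mA : measurable ([set q | C q.1.1 /\ B (tnth q.1.2 ord_max)] :
    set (n.-tuple R * 2.-tuple R * R)).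
  apply: measurableI; rewrite -[X in measurable X]setTI.
    exact: (measurableT_comp (@measurable_fst _ _ (n.-tuple R) (2.-tuple R))
      (@measurable_fst _ _ _ R)).
  exact: (measurableT_comp (measurableT_comp (@measurable_tnth _ _ _ ord_max)
      (@measurable_snd _ _ (n.-tuple R) (2.-tuple R))) (@measurable_fst _ _ _ R)).
have := liouville_joint_law (grid_of_path (path2 s0 st t1)) mA.
rewrite (_ : _ @^-1` _ = xi s @^-1` C `&` total t @^-1` B); last first.
  by apply/seteqP; split => w /=; rewrite tnth_mktuple.
rewrite [X in _ = PL X](_ : _ =
    (fun w => [tuple increment L (block_grid s [:: c * t]) i w | i < n]) @^-1` C `&`
    L (block_grid s [:: c * t] n.+1) @^-1` B); last first.
  rewrite -(@first_block_tuple s (nth 1 [:: 0; s; t]))// a_end.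
  by apply/seteqP; split => w /=; rewrite tnth_mktuple.
move=> ->; apply: (etrans (bridge_transition c0 levyX Xf procL LT Lcdf grid_a mC mB)).
apply: eq_integral => x _; apply: eq_integral => y _.
by rewrite ThetaE ?gt_eqF// a_end a_n tsE.
Qed.


Let mTheta s : 0 <= s -> s < 1 ->
  measurable_fun setT (fun x : n.-tuple R => Theta f c nu s (ones_dot x)).
Proof.
move=> s0 s1.
exact: (measurableT_comp (measurable_theta s0 s1 measurableT) measurable_ones_dot).
Qed.

Lemma final_cond_law s : 0 <= s -> s < 1 ->
  cond_law_version P (total 1) (xi s)
    (fun x B => (theta f c nu s B (ones_dot x) / Theta f c nu s (ones_dot x))%E).
Proof.
move=> s0 s1; have [mu joint] := final_disintegration s0 s1.
pose K (x : n.-tuple R) := sval (cid (theta_measure (ones_dot x) s0 s1)).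
have KE x B : measurable B -> K x B = theta f c nu s B (ones_dot x).
  exact: (svalP (cid (theta_measure (ones_dot x) s0 s1))).
have mK B : measurable B ->
    measurable_fun setT (fun x : n.-tuple R => theta f c nu s B (ones_dot x)).
  move=> mB.
  exact: (measurableT_comp (measurable_theta s0 s1 mB) measurable_ones_dot).
apply: (@cond_law_of_kernel _ _ _ P _ _ (xi s) (total 1) (measurable_xi s0 (ltW s1))
  mu (fun x => Theta f c nu s (ones_dot x)) K _ (mTheta s0 s1)).
- by move=> x; exact: theta_ge0.
- by apply: aeW => x; exact: KE.
- move=> B mB; under eq_fun do rewrite KE//; exact: mK.
- by move=> C B mC mB; rewrite joint//; apply: eq_integral => x _; rewrite KE.
- move=> B mB; apply: measurable_dive; [exact: mK|exact: mTheta|].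
  by move=> x; exact: theta_ge0.
- by move=> x B; rewrite mule_ge0 ?inve_ge0 ?theta_ge0.
- by move=> x B mB _ _; rewrite KE.
Qed.

Lemma transition_cond_law s t : 0 <= s -> s < t -> t < 1 ->
  cond_law_version P (total t) (xi s)
    (fun x B => (\int[lebesgue_measure]_(y in B)
       (Theta f c nu t y / Theta f c nu s (ones_dot x)
        * f ((t - s) * c)%R (y - ones_dot x)%R))%E).
Proof.
move=> s0 st t1; have [mu [mass joint]] := transition_disintegration s0 st t1.
have t0 : 0 <= t by rewrite (le_trans s0)// ltW.
have s1 : s < 1 by rewrite (lt_trans st).
pose h (x : n.-tuple R) y :=
  (Theta f c nu t y * f ((t - s) * c)%R (y - ones_dot x)%R)%E.
have h0 x y : (0 <= h x y)%E.
  have := transition_density_ge0 s0 st t1 x y (fun=> lee01 (R := R)).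
  by rewrite mule1.
have mh x : measurable_fun setT (h x).
  have mpair : measurable_fun setT (fun y : R => (x, y)).
    by apply/measurable_fun_pairP; split; [exact: measurable_cst|exact: measurable_id].
  have := measurableT_comp
    (measurable_transition_density s0 st t1 (measurable_cst 1%E)) mpair.
  by rewrite (_ : _ \o _ = h x)//; apply/funext => y; rewrite /= mule1.
pose K0 x : {measure set (measurableTypeR R) -> \bar R} :=
  density_measure lebesgue_measure (mh x) (h0 x).
(* Lebesgue measure lives on a copy of the line with another display. *)
have mid : measurable_fun setT (fun y : measurableTypeR R => y : R) by [].
pose K x : {measure set R -> \bar R} :=
  image_measure (K0 x) mid.
have inv0 (x : n.-tuple R) : (0 <= (Theta f c nu s (ones_dot x))^-1)%E.
  by rewrite inve_ge0 theta_ge0.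
apply: (@cond_law_of_kernel _ _ _ P _ _ (xi s) (total t) (measurable_xi s0 (ltW s1))
  mu (fun x => Theta f c nu s (ones_dot x)) K _ (mTheta s0 s1)).
- by move=> x; exact: theta_ge0.
- exact: mass.
- move=> B mB.
  have := measurable_transition s0 st t1 (measurable_cst 1%E) (fun=> lee01) mB.
  by under eq_fun do under eq_integral do rewrite mule1.
- exact: joint.
- move=> B mB.
  apply: (measurable_transition s0 st t1 (g := fun x => (Theta f c nu s (ones_dot x))^-1)%E) => //.
  by apply: measurable_inve => [|x]; [exact: mTheta|exact: theta_ge0].
- move=> x B; apply: integral_ge0 => y _.
  exact: (transition_density_ge0 s0 st t1 x y inv0).
- move=> x B mB _ _; rewrite /K /K0 /= /pushforward /density_measure -ge0_integralZr//.
  + by apply: eq_integral => y _; rewrite /h muleAC.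
  + have mhx : @measurable_fun _ _ (measurableTypeR R) _ setT (h x) := mh x.
    exact: (measurable_funTS mhx).
Qed.

End liouville_total.

Unset Implicit Arguments.

Theorem proposition3p12 (R : realType) (d : measure_display)
    (W : measurableType d) (P : probability W R)
    (n : nat) (hn : (2 <= n)%N)
    (m : n.-tuple R) (hm : forall i, 0 < tnth m i)
    (nu : probability R R) (hnu : no_continuous_singular_part nu)
    (f : R -> R -> \bar R) (xi : R -> W -> n.-tuple R)
    (hxi : GLP_with f nu m P xi) :
  let c := ones_dot m in
  let r := fun (t : R) (w : W) => ones_dot (xi t w) in
  [/\ LRB 1 nu P r,
      forall s : R, 0 <= s -> s < 1 ->
        cond_law_version P (r 1) (xi s)
          (fun x B =>
             (theta f c nu s B (ones_dot x) / Theta f c nu s (ones_dot x))%E) &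
      forall s t : R, 0 <= s -> s < t -> t < 1 ->
        cond_law_version P (r t) (xi s)
          (fun x B =>
             (\int[lebesgue_measure]_(y in B)
                (Theta f c nu t y / Theta f c nu s (ones_dot x)
                 * f ((t - s) * c)%R (y - ones_dot x)%R))%E)].
Proof.
case: n hn m hm xi hxi => [//|p] hn m hm xi
  [procxi [dL [WL [PL [L [[_ [[dX [WX [PX [X [levyX Xf]]]]]
    [conv [fT [procL [LT Lcdf]]]]]] xiL]]]]]] c r.
rewrite /c /r ones_dot_usum; split.
- exact: (total_is_LRB hn hm levyX Xf conv fT procL LT Lcdf procxi xiL).
- move=> s s0 s1.
  exact: (final_cond_law hn hm levyX Xf procL LT Lcdf procxi xiL s0 s1).
- move=> s t s0 st t1.
  exact: (transition_cond_law hn hm levyX Xf conv fT procL LT Lcdf procxi xiL s0 st t1).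
Qed.
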